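(* Let $0<a\le\infty$ and let $k(t)$ be in $\mathcal{K}_a$. If $\operatorname{Re}(\lambda)>1$ and $\lambda\ne 1,2,3,\dots$, then $$\mathrm{f.p.}\!\int_0^a \frac{k(t)\ln^n t}{t^{\lambda}}\,dt=\mathcal{M}_a^*[k(t)\ln^n t;1-\lambda]$$ for all positive integers $n$.
   Context: Class $\mathcal{K}_a$ ($0<a\le\infty$): functions $k(t)$ of a real variable such that (1) $k(0)\ne 0$; (2) $k(t)$ is the restriction to $[0,a)$ of a complex function $k(z)$ (the complex extension) that is analytic at every point of $[0,a)$; (3) the Mellin transform $\mathcal{M}_a[k(t);1-\lambda]=\int_0^a k(t)t^{-\lambda}\,dt$ exists for $d<\operatorname{Re}(\lambda)<1$ for some $d<1$ (the strip of analyticity; $d=-\infty$ if $a<\infty$, while $d$ may be finite or $-\infty$ if $a=\infty$). $\mathcal{M}_a[k(t)\ln^n t;1-\lambda]=\int_0^a k(t)\ln^n t\;t^{-\lambda}\,dt$ for $d<\operatorname{Re}(\lambda)<1$, and $\mathcal{M}_a^*[k(t)\ln^n t;1-\lambda]$ denotes its analytic continuation (in $\lambda$) to the region $\operatorname{Re}(\lambda)\ge 1$, isolated singularities excepted. Finite-part integral: for finite $a$ write, for small $\epsilon>0$, $\int_\epsilon^a k(t)\ln^n t\;t^{-\lambda}\,dt=C_\epsilon+D_\epsilon$, where $C_\epsilon$ is the group of terms that converge as $\epsilon\to0^+$ and $D_\epsilon$ is the group of terms that have no finite limit, consisting only of such terms in powers of $\epsilon$ (possibly with complex exponents) and $\ln\epsilon$,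 with no constant term. Then $\mathrm{f.p.}\!\int_0^a k(t)\ln^n t\;t^{-\lambda}\,dt=\lim_{\epsilon\to0}C_\epsilon$. For $a=\infty$, $\mathrm{f.p.}\!\int_0^\infty=\lim_{a\to\infty}\mathrm{f.p.}\!\int_0^a$. *)

(* Defs.v *)
From Stdlib Require Import Reals List.
From Coquelicot Require Import Coquelicot.

Open Scope R_scope.

Definition Cexp (z : C) : C := (exp (Re z) * cos (Im z), exp (Re z) * sin (Im z)).

(* t^mu for t > 0, with the real logarithm of t. *)
Definition rcpow (t : R) (mu : C) : C := Cexp (mu * RtoC (ln t))%C.

(* t -> a from below; this is [at_left a] when a is finite and t -> +oo when
   a = +oo. *)
Definition below (a : Rbar) : (R -> Prop) -> Prop :=
  within (fun t : R => Rbar_lt t a) (Rbar_locally a).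

(* Analytic at a point: sum of a power series in some neighbourhood. *)
Definition analytic_at (f : C -> C) (z0 : C) : Prop :=
  exists c : nat -> C,
    locally z0 (fun z : C =>
      is_pseries (K := C_AbsRing) (V := C_NormedModule) c (z - z0)%C (f z)).

(* k(t) ln^n(t) t^(-lambda) *)
Definition integrand (k : R -> C) (n : nat) (lambda : C) (t : R) : C :=
  (k t * RtoC (ln t ^ n) * rcpow t (- lambda))%C.

(* M_a[k(t) ln^n t; 1 - lambda] = v, as a (possibly improper) integral. *)
Definition is_Mellin (a : Rbar) (k : R -> C) (n : nat) (lambda v : C) : Prop :=
  is_RInt_gen (V := C_R_NormedModule) (integrand k n lambda)
    (at_right 0) (below a) v.

Definition in_strip (d : Rbar) (lambda : C) : Prop :=
  Rbar_lt d (Re lambda) /\ Re lambda < 1.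

(* k belongs to the class K_a, with strip d < Re(lambda) < 1. *)
Definition class_K (a : Rbar) (d : Rbar) (k : R -> C) : Prop :=
  k 0 <> RtoC 0 /\
  (exists kc : C -> C, forall t : R, 0 <= t -> Rbar_lt t a ->
     k t = kc (RtoC t) /\ analytic_at kc (RtoC t)) /\
  Rbar_lt d 1 /\
  (is_finite a -> d = m_infty) /\
  (forall lambda : C, in_strip d lambda -> exists v : C, is_Mellin a k 0 lambda v).

(* M continues lambda |-> M_a[k(t) ln^n t; 1 - lambda] analytically from the
   strip to Re(lambda) >= 1, isolated singularities excepted: M is analytic in
   a punctured neighbourhood of each point with Re(z) >= 1.  The value of M at a
   point where M is not analytic carries no information. *)
Definition is_Mellin_continuation (a d : Rbar) (k : R -> C) (n : nat)
    (M : C -> C) : Prop :=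
  (forall z : C, in_strip d z -> is_Mellin a k n z (M z) /\ analytic_at M z) /\
  (forall z : C, 1 <= Re z -> locally' z (analytic_at M)).

(* M_a^*[k(t) ln^n t; 1 - lambda] is defined and equal to v. *)
Definition is_Mellin_star (a d : Rbar) (k : R -> C) (n : nat) (lambda v : C) : Prop :=
  exists M : C -> C,
    is_Mellin_continuation a d k n M /\ analytic_at M lambda /\ M lambda = v.

(* A term c eps^alpha ln^m(eps), encoded as (c, alpha, m). *)
Definition fp_term (p : C * C * nat) (eps : R) : C :=
  let '(c, alpha, m) := p in (c * rcpow eps alpha * RtoC (ln eps ^ m))%C.

Definition diverges_at_0 (g : R -> C) : Prop :=
  ~ exists l : C, filterlim g (at_right 0) (locally l).

Definition fp_sum (D : list (C * C * nat)) (eps : R) : C :=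
  fold_right (fun p s => (fp_term p eps + s)%C) (RtoC 0) D.

(* Finite a: int_eps^a f = C_eps + D_eps for small eps > 0, where D_eps is a
   finite sum of divergent terms and C_eps -> v.  The integral may be improper
   at a. *)
Definition is_fp_finite (f : R -> C) (a : R) (v : C) : Prop :=
  exists (D : list (C * C * nat)) (Ceps : R -> C),
    List.Forall (fun p => diverges_at_0 (fp_term p)) D /\
    at_right 0 (fun eps : R =>
      is_RInt_gen (V := C_R_NormedModule) f (at_point eps) (at_left a)
        (Ceps eps + fp_sum D eps)%C) /\
    filterlim Ceps (at_right 0) (locally v).

Definition is_fp (f : R -> C) (a : Rbar) (v : C) : Prop :=
  match a with
  | Finite a => is_fp_finite f a v
  | p_infty =>
      exists F : R -> C,
        (forall b : R, 0 < b -> is_fp_finite f b (F b)) /\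
        filterlim F (Rbar_locally p_infty) (locally v)
  | m_infty => False
  end.

(* Main.v *)
Require Import Defs.
From Stdlib Require Import Reals List Lra Lia Classical IndefiniteDescription.
From Coquelicot Require Import Coquelicot.

Open Scope R_scope.

(** Fix the Taylor coefficients [c j] of [k] at 0 and let [Phi] be any primitive
    of [k t * ln^n t * t^(-z)] on the open interval from 0 to [a].  Two facts
    drive the proof.

    At 0: the function [t^(j-z) * ln^n t] has an explicit primitive, [t^p] times
    a polynomial in [ln t], with [p = j + 1 - z]; it exists for every [j] as soon
    as [z] is none of 1, 2, 3, ...  Subtracting from [Phi] the sum over [j < N]
    of [c j] times these primitives leaves a primitive of
    [O(t^(N - Re z) * ln^n t)], which has a limit [l0] at 0 when [N] is large.

    At [a]: [Phi] has a limit [la] as soon as [d < Re z].  The Mellin integral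
    for [n = 0] may converge only conditionally, so this is an integration by
    parts: for a real [sigma] of the strip with [sigma < Re z], let [H] be the
    tail of the integral of [k t * t^(-sigma)]; then [H] is bounded and tends to
    0 at [a], and the integrand is [- H'] times [t^(sigma - z) * ln^n t].

    The number [la - l0] is independent of [Phi] and [N] ([fp_value_unique]), and
    it plays three parts at once.
    - When [Re z < 1] the subtracted primitives vanish at 0, and [la - l0] is the
      Mellin integral ([fp_value_is_Mellin]).
    - When [z] is not a positive integer the subtracted primitives are
      combinations of terms [eps^p * ln^i eps] with [p <> 0]; each of them tends
      to 0 if [0 < Re p] and has no limit otherwise (it blows up, or it
      oscillates when [Re p = 0] and [i = 0]).  None of them can hide a finite
      constant, so [la - l0] is the finite part ([fp_value_is_fp]).
    - It is analytic in [z] away from 1, 2, 3, ... ([fp_value_germ]).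

    So [z |-> la - l0] continues the Mellin transform, which gives existence, and
    the identity theorem ([identity_theorem]) forces every other continuation
    with isolated singularities to take the same value at [lambda].

    Analyticity means here being the sum of a power series, and it is obtained by
    exhibiting the series: [t^(-z) = t^(-z0) * exp (-(z - z0) * ln t)], and the
    Taylor remainder of order [N] of the exponential is at most
    [2^(-N) * exp (2 * |z - z0| * |ln t|)], so integrating term by term costs at
    most [2^(-N)] times one fixed convergent integral ([mellin_germ]).
    Integrals are handled through primitives throughout: all estimates then
    follow from one mean value inequality ([mean_value_C]), and improper
    integrals are limits of primitives. *)

(** * Limits and derivatives of complex-valued functions *)

Definition Clim {T : Type} (F : (T -> Prop) -> Prop) (f : T -> C) (l : C) : Prop :=
  filterlim f F (locally l).

Definition Cderive (f : R -> C) (t : R) (l : C) : Prop :=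
  is_derive (K := R_AbsRing) (V := C_R_NormedModule) f t l.

Lemma norm_R_Cmod (z : C) : norm (K := R_AbsRing) (V := C_R_NormedModule) z = Cmod z.
Proof.
  unfold Cmod. change (sqrt (Rabs (fst z) ^ 2 + Rabs (snd z) ^ 2) = sqrt (fst z ^ 2 + snd z ^ 2)).
  now rewrite !pow2_abs.
Qed.

Lemma locally_Cmod (z0 : C) (P : C -> Prop) :
  locally z0 P <-> exists r : R, 0 < r /\ forall z : C, Cmod (z - z0) < r -> P z.
Proof.
  split.
  - intros H.
    destruct (locally_norm_le_locally (K := C_AbsRing) (V := C_NormedModule) z0 P H) as [e He].
    exists e; split; [apply cond_pos|]. intros z Hz. apply He. exact Hz.
  - intros [r [Hr H]].
    apply (locally_le_locally_norm (K := C_AbsRing) (V := C_NormedModule) z0 P).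
    exists (mkposreal r Hr). intros z Hz. apply H. exact Hz.
Qed.

Lemma filterlim_Cmod {T : Type} (F : (T -> Prop) -> Prop) {FF : Filter F} (f : T -> C) (l : C) :
  filterlim f F (locally l) <->
  forall eps : R, 0 < eps -> F (fun x => Cmod (f x - l) < eps).
Proof.
  split.
  - intros H eps He. apply (H (fun z => Cmod (z - l) < eps)).
    apply locally_Cmod. now exists eps.
  - intros H P HP. apply locally_Cmod in HP. destruct HP as [r [Hr HP]].
    unfold filtermap. generalize (H r Hr). apply filter_imp. intros x. apply HP.
Qed.

Lemma Clim_unique {T : Type} (F : (T -> Prop) -> Prop) {FF : ProperFilter F} f l1 l2 :
  Clim F f l1 -> Clim F f l2 -> l1 = l2.
Proof.
  intros H1 H2.
  exact (filterlim_locally_unique (K := C_AbsRing) (V := C_NormedModule) f l1 l2 H1 H2).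
Qed.

Lemma Clim_const {T : Type} (F : (T -> Prop) -> Prop) {FF : Filter F} (c : C) : Clim F (fun _ => c) c.
Proof. apply filterlim_const. Qed.

Lemma Clim_ext {T : Type} (F : (T -> Prop) -> Prop) {FF : Filter F} f g l :
  F (fun t => f t = g t) -> Clim F f l -> Clim F g l.
Proof. intros H. apply filterlim_ext_loc, H. Qed.

Lemma Clim_plus {T : Type} (F : (T -> Prop) -> Prop) {FF : Filter F} f g lf lg :
  Clim F f lf -> Clim F g lg -> Clim F (fun t => f t + g t)%C (lf + lg)%C.
Proof.
  intros Hf Hg. unfold Clim.
  eapply filterlim_comp_2; [exact Hf|exact Hg|].
  exact (filterlim_plus (K := C_AbsRing) (V := C_NormedModule) lf lg).
Qed.

Lemma Clim_scal {T : Type} (F : (T -> Prop) -> Prop) {FF : Filter F} (c : C) f l :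
  Clim F f l -> Clim F (fun t => c * f t)%C (c * l)%C.
Proof.
  intros Hf. unfold Clim.
  eapply filterlim_comp; [exact Hf|].
  exact (filterlim_scal_r (K := C_AbsRing) (V := C_NormedModule) c l).
Qed.

Lemma Clim_minus {T : Type} (F : (T -> Prop) -> Prop) {FF : Filter F} f g lf lg :
  Clim F f lf -> Clim F g lg -> Clim F (fun t => f t - g t)%C (lf - lg)%C.
Proof.
  intros Hf Hg. replace (lf - lg)%C with (lf + (-1) * lg)%C by ring.
  apply (Clim_ext F (fun t => f t + (-1) * g t)%C).
  - apply filter_forall. intros t. ring.
  - apply (Clim_plus F); [exact Hf|]. now apply (Clim_scal F).
Qed.

Lemma Clim_bounded {T : Type} (F : (T -> Prop) -> Prop) {FF : Filter F} f l :
  Clim F f l -> F (fun t => Cmod (f t) <= Cmod l + 1).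
Proof.
  intros H. generalize (proj1 (filterlim_Cmod F f l) H 1 Rlt_0_1).
  apply filter_imp. intros t Ht.
  replace (f t) with (l + (f t - l))%C by ring.
  generalize (Cmod_triangle l (f t - l)). lra.
Qed.

Lemma Clim_0_mult_bounded {T : Type} (F : (T -> Prop) -> Prop) {FF : Filter F} f g B :
  Clim F f 0 -> F (fun t => Cmod (g t) <= B) -> Clim F (fun t => f t * g t)%C 0.
Proof.
  intros Hf Hg. apply (filterlim_Cmod F); intros eps Heps.
  assert (HB : 0 < Rmax B 0 + 1) by (generalize (Rmax_r B 0); lra).
  generalize (filter_and _ _ (proj1 (filterlim_Cmod F f 0) Hf (eps / (Rmax B 0 + 1))
    (Rdiv_lt_0_compat _ _ Heps HB)) Hg).
  apply filter_imp. intros t [H1 H2].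
  replace (f t * g t - 0)%C with (f t * g t)%C by ring.
  replace (f t - 0)%C with (f t) in H1 by ring.
  rewrite Cmod_mult.
  apply Rle_lt_trans with (Cmod (f t) * (Rmax B 0 + 1)).
  - apply Rmult_le_compat_l; [apply Cmod_ge_0|]. generalize (Rmax_l B 0); lra.
  - apply (Rmult_lt_compat_r (Rmax B 0 + 1)) in H1; [|exact HB].
    now replace (eps / (Rmax B 0 + 1) * (Rmax B 0 + 1)) with eps in H1 by (field; lra).
Qed.

Lemma Clim_mult {T : Type} (F : (T -> Prop) -> Prop) {FF : Filter F} f g lf lg :
  Clim F f lf -> Clim F g lg -> Clim F (fun t => f t * g t)%C (lf * lg)%C.
Proof.
  intros Hf Hg.
  replace (lf * lg)%C with (0 + lf * lg)%C by ring.
  apply (Clim_ext F (fun t => (f t - lf) * g t + lf * g t)%C).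
  - apply filter_forall. intros t. ring.
  - apply (Clim_plus F); [|now apply (Clim_scal F)].
    apply (Clim_0_mult_bounded F _ g (Cmod lg + 1)); [|now apply (Clim_bounded F)].
    replace (RtoC 0) with (lf - lf)%C by ring.
    apply (Clim_minus F); [exact Hf|apply (Clim_const F)].
Qed.

Lemma Clim_0_le {T : Type} (F : (T -> Prop) -> Prop) {FF : Filter F} f (b : T -> R) :
  F (fun t => Cmod (f t) <= b t) -> filterlim b F (locally 0) -> Clim F f 0.
Proof.
  intros H Hb. apply (filterlim_Cmod F); intros eps Heps.
  assert (Hb' : F (fun t => Rabs (b t) < eps)).
  { apply (Hb (fun y => Rabs y < eps)). exists (mkposreal eps Heps). intros y Hy.
    change (Rabs (y - 0) < eps) in Hy. now rewrite Rminus_0_r in Hy. }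
  generalize (filter_and _ _ H Hb'). apply filter_imp. intros t [H1 H2].
  replace (f t - 0)%C with (f t) by ring.
  generalize (Rle_abs (b t)). lra.
Qed.

Lemma Cderive_pair f t l :
  Cderive f t l <->
  is_derive (fun x => Re (f x)) t (Re l) /\ is_derive (fun x => Im (f x)) t (Im l).
Proof.
  split.
  - intros H. split.
    + exact (filterdiff_comp' (K := R_AbsRing) (U := R_NormedModule) (V := C_R_NormedModule)
        (W := R_NormedModule) f (fun z => fst z) t (fun y => scal y l) (fun z => fst z) H
        (filterdiff_linear (K := R_AbsRing) (U := C_R_NormedModule) (V := R_NormedModule)
         (fun z => fst z) is_linear_fst)).
    + exact (filterdiff_comp' (K := R_AbsRing) (U := R_NormedModule) (V := C_R_NormedModule)
        (W := R_NormedModule) f (fun z => snd z) t (fun y => scal y l) (fun z => snd z) H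
        (filterdiff_linear (K := R_AbsRing) (U := C_R_NormedModule) (V := R_NormedModule)
         (fun z => snd z) is_linear_snd)).
  - intros [H1 H2].
    assert (K := is_derive_plus (K := R_AbsRing) (V := C_R_NormedModule) _ _ t _ _
      (is_derive_scal_l (K := R_AbsRing) (V := C_R_NormedModule) _ t _ (1, 0) H1)
      (is_derive_scal_l (K := R_AbsRing) (V := C_R_NormedModule) _ t _ (0, 1) H2)).
    unfold Cderive.
    assert (E : forall u v : R, plus (scal u ((1, 0) : C_R_NormedModule)) (scal v ((0, 1) : C_R_NormedModule)) = (u, v)).
    { intros u v. apply injective_projections; simpl; unfold plus, scal; simpl;
        unfold mult; simpl; ring. }
    rewrite E in K. destruct l as [l1 l2]. simpl in K.
    eapply is_derive_ext; [|exact K].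
    intros x. simpl. rewrite E. now destruct (f x).
Qed.

Lemma Cderive_const c t : Cderive (fun _ => c) t 0.
Proof. apply Cderive_pair; split; simpl; apply (is_derive_const (K := R_AbsRing) (V := R_NormedModule)). Qed.

Lemma Cderive_ext f g t l : (forall x, f x = g x) -> Cderive f t l -> Cderive g t l.
Proof. intros H. apply is_derive_ext, H. Qed.

Lemma Cderive_plus f g t lf lg :
  Cderive f t lf -> Cderive g t lg -> Cderive (fun x => f x + g x)%C t (lf + lg)%C.
Proof. intros Hf Hg. exact (is_derive_plus (K := R_AbsRing) (V := C_R_NormedModule) f g t lf lg Hf Hg). Qed.

Lemma Cderive_mult f g t lf lg :
  Cderive f t lf -> Cderive g t lg ->
  Cderive (fun x => f x * g x)%C t (lf * g t + f t * lg)%C.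
Proof.
  intros Hf Hg. apply Cderive_pair in Hf, Hg. destruct Hf as [Hf1 Hf2], Hg as [Hg1 Hg2].
  apply Cderive_pair. unfold Re, Im in *. simpl. split.
  - replace (fst lf * fst (g t) - snd lf * snd (g t) + (fst (f t) * fst lg - snd (f t) * snd lg))
      with ((fst lf * fst (g t) + fst (f t) * fst lg) - (snd lf * snd (g t) + snd (f t) * snd lg)) by ring.
    apply (is_derive_minus (K := R_AbsRing) (V := R_NormedModule));
      apply (is_derive_mult (K := R_AbsRing)); try assumption; intros; apply Rmult_comm.
  - replace (fst lf * snd (g t) + snd lf * fst (g t) + (fst (f t) * snd lg + snd (f t) * fst lg))
      with ((fst lf * snd (g t) + fst (f t) * snd lg) + (snd lf * fst (g t) + snd (f t) * fst lg)) by ring.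
    apply (is_derive_plus (K := R_AbsRing) (V := R_NormedModule));
      apply (is_derive_mult (K := R_AbsRing)); try assumption; intros; apply Rmult_comm.
Qed.

Lemma Cderive_scal c f t l : Cderive f t l -> Cderive (fun x => c * f x)%C t (c * l)%C.
Proof.
  intros H. replace (c * l)%C with (0 * f t + c * l)%C by ring.
  apply (Cderive_mult (fun _ => c)); [apply Cderive_const|exact H].
Qed.

Lemma Cderive_minus f g t lf lg :
  Cderive f t lf -> Cderive g t lg -> Cderive (fun x => f x - g x)%C t (lf - lg)%C.
Proof. intros Hf Hg. exact (is_derive_minus (K := R_AbsRing) (V := C_R_NormedModule) f g t lf lg Hf Hg). Qed.

Lemma Cderive_RtoC f t l : is_derive f t l -> Cderive (fun x => RtoC (f x)) t (RtoC l).
Proof.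
  intros H. apply Cderive_pair; split; simpl; [exact H|].
  apply (is_derive_const (K := R_AbsRing) (V := R_NormedModule)).
Qed.

Lemma Cderive_continuous f t l : Cderive f t l -> continuous f t.
Proof. intros H. apply (ex_derive_continuous (K := R_AbsRing) (V := C_R_NormedModule)). now exists l. Qed.

Lemma continuous_Cmult (f g : R -> C) t :
  continuous f t -> continuous g t -> continuous (fun x => f x * g x)%C t.
Proof. exact (Clim_mult (locally t) f g (f t) (g t)). Qed.

Lemma continuous_Cplus (f g : R -> C) t :
  continuous f t -> continuous g t -> continuous (fun x => f x + g x)%C t.
Proof. intros Hf Hg. exact (continuous_plus (K := C_AbsRing) (V := C_NormedModule) f g t Hf Hg). Qed.

Lemma continuous_Cminus (f g : R -> C) t :
  continuous f t -> continuous g t -> continuous (fun x => f x - g x)%C t.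
Proof. intros Hf Hg. exact (continuous_minus (K := C_AbsRing) (V := C_NormedModule) f g t Hf Hg). Qed.

(** * Mean value inequality and comparison test *)

(** Reduces to the real mean value theorem: project [f] on the direction
    [f y - f x] and subtract the correspondingly scaled [W]; the difference has a
    nonpositive derivative. *)
Lemma mean_value_C (f : R -> C) (df : R -> C) (W w : R -> R) (x y : R) :
  x <= y ->
  (forall t, x <= t <= y -> Cderive f t (df t)) ->
  (forall t, x <= t <= y -> is_derive W t (w t)) ->
  (forall t, x <= t <= y -> Cmod (df t) <= w t) ->
  Cmod (f y - f x) <= W y - W x.
Proof.
  intros Hxy Hf HW Hle.
  set (e := (f y - f x)%C).
  set (psi := fun t => Re e * Re (f t) + Im e * Im (f t)).
  set (dpsi := fun t => Re e * Re (df t) + Im e * Im (df t)).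
  assert (Hpsi : forall t, x <= t <= y -> is_derive psi t (dpsi t)).
  { intros t Ht. destruct (proj1 (Cderive_pair _ _ _) (Hf t Ht)) as [H1 H2].
    apply (is_derive_plus (K := R_AbsRing) (V := R_NormedModule)).
    - apply (is_derive_scal _ _ _ _ H1).
    - apply (is_derive_scal _ _ _ _ H2). }
  assert (Hcs : forall t, dpsi t <= Cmod e * Cmod (df t)).
  { intros t. unfold dpsi.
    assert (E : Re e * Re (df t) + Im e * Im (df t) = Re (e * Cconj (df t))%C).
    { unfold Re, Im, Cconj; simpl; ring. }
    rewrite E. eapply Rle_trans; [apply Rle_abs|].
    eapply Rle_trans; [apply re_le_Cmod|]. rewrite Cmod_mult, Cmod_conj. lra. }
  destruct (MVT_gen (fun t => psi t - Cmod e * W t) x y (fun t => dpsi t - Cmod e * w t)) as [c [Hc Heq]].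
  - rewrite Rmin_left, Rmax_right by lra. intros t Ht.
    apply (is_derive_minus (K := R_AbsRing) (V := R_NormedModule)).
    + apply Hpsi; lra.
    + apply is_derive_scal. apply HW; lra.
  - rewrite Rmin_left, Rmax_right by lra. intros t Ht.
    apply continuity_pt_filterlim.
    apply (ex_derive_continuous (K := R_AbsRing) (V := R_NormedModule)
      (fun t => psi t - Cmod e * W t)).
    exists (dpsi t - Cmod e * w t).
    apply (is_derive_minus (K := R_AbsRing) (V := R_NormedModule)).
    + apply Hpsi; lra.
    + apply is_derive_scal. apply HW; lra.
  - rewrite Rmin_left, Rmax_right in Hc by lra.
    assert (Hneg : dpsi c - Cmod e * w c <= 0).
    { generalize (Hcs c). generalize (Hle c Hc). generalize (Cmod_ge_0 e). nra. }
    assert (Hsq : psi y - psi x = Cmod e ^ 2).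
    { rewrite Cmod2_alt. unfold psi, e. unfold Re, Im; simpl. ring. }
    assert (H : psi y - psi x <= Cmod e * (W y - W x)).
    { assert (0 <= y - x) by lra. nra. }
    rewrite Hsq in H.
    assert (HWm : 0 <= W y - W x).
    { destruct (MVT_gen W x y w) as [c' [Hc' Heq']].
      - rewrite Rmin_left, Rmax_right by lra. intros; apply HW; lra.
      - rewrite Rmin_left, Rmax_right by lra. intros t Ht.
        apply continuity_pt_filterlim.
        apply (ex_derive_continuous (K := R_AbsRing) (V := R_NormedModule) W).
        exists (w t); apply HW; lra.
      - rewrite Rmin_left, Rmax_right in Hc' by lra. rewrite Heq'.
        generalize (Hle c' Hc') (Cmod_ge_0 (df c')). nra. }
    destruct (Req_dec (Cmod e) 0) as [E|E]; [rewrite E; exact HWm|].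
    generalize (Cmod_ge_0 e). intros. nra.
Qed.

Lemma mean_value_C_abs (f : R -> C) (df : R -> C) (W w : R -> R) (x y : R) :
  (forall t, Rmin x y <= t <= Rmax x y -> Cderive f t (df t)) ->
  (forall t, Rmin x y <= t <= Rmax x y -> is_derive W t (w t)) ->
  (forall t, Rmin x y <= t <= Rmax x y -> Cmod (df t) <= w t) ->
  Cmod (f y - f x) <= Rabs (W y - W x).
Proof.
  intros Hf HW Hle. destruct (Rle_or_lt x y) as [H|H].
  - rewrite Rmin_left, Rmax_right in * by lra.
    eapply Rle_trans; [|apply Rle_abs]. now apply (mean_value_C f df W w).
  - rewrite Rmin_right, Rmax_left in * by lra.
    rewrite Rabs_minus_sym. eapply Rle_trans; [|apply Rle_abs].
    rewrite <- Cmod_opp. replace (- (f y - f x))%C with (f x - f y)%C by ring.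
    apply (mean_value_C f df W w); auto; lra.
Qed.

Definition convex (I : R -> Prop) : Prop :=
  forall x y t, I x -> I y -> x <= t <= y -> I t.

Lemma convex_between I x y t : convex I -> I x -> I y -> Rmin x y <= t <= Rmax x y -> I t.
Proof.
  intros HI Hx Hy. unfold Rmin, Rmax. destruct (Rle_dec x y); intros Ht.
  - now apply (HI x y).
  - now apply (HI y x).
Qed.

Lemma Clim_le {T : Type} (F : (T -> Prop) -> Prop) {FF : ProperFilter F} f l (b : T -> R) (lb : R) :
  F (fun t => Cmod (f t) <= b t) -> Clim F f l -> filterlim b F (locally lb) -> Cmod l <= lb.
Proof.
  intros H Hf Hb.
  apply (filterlim_le (F := F) (fun t => Cmod (f t)) b (Cmod l) lb H); [|exact Hb].
  exact (filterlim_comp _ _ _ f (fun z : C => norm (K := C_AbsRing) (V := C_NormedModule) z) F _ _ Hf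
    (filterlim_norm (K := C_AbsRing) (V := C_NormedModule) l)).
Qed.

(** Comparison test for improper integrals, phrased for primitives.  The filter
    [F] may be a one-sided neighbourhood of an endpoint, a neighbourhood of
    infinity or a single point, so that improper integrals at both ends and proper
    integrals are covered at once. *)
Lemma dominated_limit (F : (R -> Prop) -> Prop) {FF : ProperFilter F} (I : R -> Prop)
  (f df : R -> C) (W w : R -> R) (x0 L : R) :
  convex I -> F I -> I x0 ->
  (forall t, I t -> Cderive f t (df t)) ->
  (forall t, I t -> is_derive W t (w t)) ->
  (forall t, I t -> Cmod (df t) <= w t) ->
  filterlim W F (locally L) ->
  exists l, Clim F f l /\ Cmod (l - f x0) <= Rabs (L - W x0).
Proof.
  intros HI HF Hx0 Hf HW Hle HL.
  assert (key : forall x y, I x -> I y -> Cmod (f y - f x) <= Rabs (W y - W x)).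
  { intros x y Hx Hy.
    apply (mean_value_C_abs f df W w); intros t Ht;
      [apply Hf|apply HW|apply Hle]; now apply (convex_between I x y). }
  assert (Hex : exists l, Clim F f l).
  { apply (filterlim_locally_cauchy (U := C_R_CompleteNormedModule) (F := F) f).
    intros eps.
    pose proof (proj2 (filterlim_locally_cauchy (U := R_CompleteNormedModule) (F := F) W)
      (ex_intro _ L HL)) as HW'.
    destruct (HW' eps) as [P [HP HPe]].
    exists (fun t => P t /\ I t). split; [now apply filter_and|].
    intros u v [Hu Iu] [Hv Iv].
    apply C_NormedModule_mixin_compat1. specialize (HPe u v Hu Hv).
    change (Rabs (W v - W u) < eps) in HPe.
    eapply Rle_lt_trans; [|exact HPe]. now apply key. }
  destruct Hex as [l Hl]. exists l. split; [exact Hl|].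
  apply (Clim_le F (fun t => f t - f x0)%C _ (fun t => Rabs (W t - W x0))).
  - revert HF. apply filter_imp. intros t It. now apply key.
  - apply (Clim_minus F); [exact Hl|apply (Clim_const F)].
  - apply (filterlim_comp _ _ _ (fun t => W t - W x0) Rabs F (locally (L - W x0))).
    + apply (filterlim_comp_2 (F := F) (G := locally L) (H := locally (W x0)) W (fun _ => W x0) Rminus HL).
      * apply filterlim_const.
      * apply (filterlim_comp_2 (F := filter_prod (locally L) (locally (W x0))) (G := locally L) (H := locally (- W x0)) fst (fun z => - snd z) Rplus).
        -- apply filterlim_fst.
        -- apply (filterlim_comp _ _ _ snd Ropp _ (locally (W x0))); [apply filterlim_snd|].
           apply (filterlim_opp (K := R_AbsRing) (V := R_NormedModule)).
        -- apply (filterlim_plus (K := R_AbsRing) (V := R_NormedModule)).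
    + apply (filterlim_norm (K := R_AbsRing) (V := R_NormedModule)).
Qed.

(** * Complex powers of a positive real *)

Lemma Cexp_plus a b : Cexp (a + b) = (Cexp a * Cexp b)%C.
Proof.
  destruct a as [a1 a2], b as [b1 b2]. unfold Cexp, Re, Im; simpl.
  rewrite exp_plus, cos_plus, sin_plus.
  apply injective_projections; simpl; ring.
Qed.

Lemma Cexp_0 : Cexp 0 = 1.
Proof.
  unfold Cexp, Re, Im; simpl. rewrite exp_0, cos_0, sin_0.
  apply injective_projections; simpl; ring.
Qed.

Lemma Cmod_Cexp z : Cmod (Cexp z) = exp (Re z).
Proof.
  unfold Cmod, Cexp; simpl.
  replace (exp (Re z) * cos (Im z) * (exp (Re z) * cos (Im z) * 1) +
    exp (Re z) * sin (Im z) * (exp (Re z) * sin (Im z) * 1))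
    with (Rsqr (exp (Re z)) * (Rsqr (sin (Im z)) + Rsqr (cos (Im z)))) by (unfold Rsqr; ring).
  rewrite sin2_cos2, Rmult_1_r. apply sqrt_Rsqr. apply Rlt_le, exp_pos.
Qed.

Lemma rcpow_plus t p q : rcpow t (p + q) = (rcpow t p * rcpow t q)%C.
Proof.
  unfold rcpow. rewrite <- Cexp_plus. f_equal. ring.
Qed.

Lemma rcpow_0 t : rcpow t 0 = 1.
Proof.
  unfold rcpow. replace (0 * RtoC (ln t))%C with (RtoC 0) by ring. apply Cexp_0.
Qed.

Lemma Cmod_rcpow t p : Cmod (rcpow t p) = exp (Re p * ln t).
Proof.
  unfold rcpow. rewrite Cmod_Cexp. f_equal. now rewrite re_scal_r.
Qed.

Lemma rcpow_1 t : 0 < t -> rcpow t 1 = t.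
Proof.
  intros Ht. unfold rcpow, Cexp. rewrite re_scal_r, im_scal_r. simpl.
  rewrite Rmult_1_l, Rmult_0_l, cos_0, sin_0, exp_ln by assumption.
  apply injective_projections; simpl; ring.
Qed.

Lemma rcpow_INR t j : 0 < t -> rcpow t (INR j) = (RtoC t ^ j)%C.
Proof.
  intros Ht. induction j as [|j IH].
  - simpl. apply rcpow_0.
  - rewrite S_INR, RtoC_plus, rcpow_plus, IH, rcpow_1 by assumption.
    rewrite Cpow_S. ring.
Qed.

Lemma rcpow_base_1 p : rcpow 1 p = 1.
Proof.
  unfold rcpow. rewrite ln_1. replace (p * 0)%C with (RtoC 0) by ring. apply Cexp_0.
Qed.

Lemma Cderive_Cexp_comp (g : R -> R) w t dg :
  is_derive g t dg -> Cderive (fun s => Cexp (w * RtoC (g s))) t (w * RtoC dg * Cexp (w * RtoC (g t)))%C.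
Proof.
  intros Hg. apply Cderive_pair.
  destruct w as [a b]. unfold Re, Im, Cexp; simpl. split.
  - evar_last.
    + apply (is_derive_ext (fun s => exp (a * g s) * cos (b * g s))).
      * intros s. unfold Re, Im; simpl. f_equal; f_equal; ring.
      * auto_derive; [repeat split; now exists dg|].
        reflexivity.
    + change (Derive (fun x => g x) t) with (Derive g t). rewrite (is_derive_unique _ _ _ Hg). unfold Re, Im; simpl.
      replace (a * g t - b * 0) with (a * g t) by ring.
      replace (a * 0 + b * g t) with (b * g t) by ring. ring.
  - evar_last.
    + apply (is_derive_ext (fun s => exp (a * g s) * sin (b * g s))).
      * intros s. unfold Re, Im; simpl. f_equal; f_equal; ring.
      * auto_derive; [repeat split; now exists dg|].
        reflexivity.
    + change (Derive (fun x => g x) t) with (Derive g t). rewrite (is_derive_unique _ _ _ Hg). unfold Re, Im; simpl.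
      replace (a * g t - b * 0) with (a * g t) by ring.
      replace (a * 0 + b * g t) with (b * g t) by ring. ring.
Qed.

Lemma Cderive_rcpow t p : 0 < t -> Cderive (fun x => rcpow x p) t (p * rcpow t (p - 1))%C.
Proof.
  intros Ht.
  assert (Hl : is_derive ln t (/ t)) by (auto_derive; [exact Ht|ring]).
  replace (p * rcpow t (p - 1))%C with (p * RtoC (/ t) * rcpow t p)%C.
  - exact (Cderive_Cexp_comp ln p t (/ t) Hl).
  - replace p with ((p - 1) + 1)%C at 2 by ring.
    rewrite rcpow_plus, rcpow_1 by assumption. rewrite RtoC_inv by lra.
    field. intros E. apply RtoC_inj in E. lra.
Qed.

Lemma Cderive_ln_pow t n : 0 < t ->
  Cderive (fun x => RtoC (ln x ^ n)) t (RtoC (INR n * ln t ^ pred n) * rcpow t (- (1)))%C.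
Proof.
  intros Ht.
  assert (E : rcpow t (- (1)) = RtoC (/ t)).
  { assert (Hm := rcpow_plus t 1 (- (1))). rewrite rcpow_1 in Hm by assumption.
    replace (1 + - (1))%C with (RtoC 0) in Hm by ring. rewrite rcpow_0 in Hm.
    rewrite RtoC_inv by lra.
    assert (Hn : RtoC t <> 0) by (intros E; apply RtoC_inj in E; lra).
    replace (rcpow t (- (1))) with (/ t * (t * rcpow t (- (1))))%C by (field; exact Hn).
    rewrite <- Hm. ring. }
  rewrite E, <- RtoC_mult. apply Cderive_RtoC. auto_derive; [exact Ht|].
  ring.
Qed.

(** * Taylor remainder of the exponential *)

(** The partial sum of the first [N] terms: an empty sum for [N = 0], unlike
    [sum_n]. *)
Fixpoint psum (c : nat -> C) (h : C) (N : nat) : C :=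
  match N with
  | O => 0
  | S N => (psum c h N + c N * h ^ N)%C
  end.

Definition exp_coef (m : nat) : C := RtoC (/ INR (Factorial.fact m)).

Lemma Cderive_psum_exp w s N :
  Cderive (fun x => psum exp_coef (w * RtoC x) (S N)) s (w * psum exp_coef (w * RtoC s) N)%C.
Proof.
  assert (Hlin : Cderive (fun x => w * RtoC x)%C s w).
  { evar_last; [apply Cderive_scal, (Cderive_RtoC (fun x => x)), (is_derive_id (K := R_AbsRing))|].
    change (w * 1 = w)%C. ring. }
  assert (Hpow : forall m, Cderive (fun x => (w * RtoC x) ^ S m)%C s (RtoC (INR (S m)) * w * (w * RtoC s) ^ m)%C).
  { induction m as [|m IH].
    - apply (Cderive_ext (fun x => w * RtoC x)%C); [intros x; now rewrite Cpow_1_r|].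
      simpl. replace (1 * w * 1)%C with w by ring. exact Hlin.
    - apply (Cderive_ext (fun x => (w * RtoC x) * (w * RtoC x) ^ S m)%C); [intros x; now rewrite (Cpow_S _ (S m))|].
      evar_last; [apply Cderive_mult; [exact Hlin|exact IH]|].
      rewrite (S_INR (S m)), RtoC_plus, !Cpow_S. ring. }
  induction N as [|N IH].
  - apply (Cderive_ext (fun _ => exp_coef 0 * 1)%C).
    + intros x. simpl. ring.
    + replace (w * psum exp_coef (w * RtoC s) 0)%C with (RtoC 0) by (simpl; ring).
      apply Cderive_const.
  - evar_last; [apply Cderive_plus; [exact IH|apply Cderive_scal, Hpow]|].
    change (psum exp_coef (w * RtoC s) (S N)) with (psum exp_coef (w * RtoC s) N + exp_coef N * (w * RtoC s) ^ N)%C.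
    assert (E : exp_coef N = (exp_coef (S N) * RtoC (INR (S N)))%C).
    { unfold exp_coef. rewrite <- RtoC_mult. f_equal.
      rewrite fact_simpl, mult_INR. field. split; [apply INR_fact_neq_0|apply not_0_INR; lia]. }
    rewrite E. ring.
Qed.

(** This bound is chosen to reproduce itself under integration: along the ray
    [s |-> s * w] the derivative of the remainder of order [S N] is [w] times the
    remainder of order [N], and [|w| * 2^(-N) * exp (2 s |w|)] is exactly the
    derivative of [2^(-(N+1)) * exp (2 s |w|)], so the mean value inequality
    propagates the bound. *)
Lemma Cexp_taylor w N :
  Cmod (Cexp w - psum exp_coef w N) <= (/ 2) ^ N * exp (2 * Cmod w).
Proof.
  assert (K : forall s, 0 <= s -> Cmod (Cexp (w * RtoC s) - psum exp_coef (w * RtoC s) N)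
     <= (/ 2) ^ N * exp (2 * Cmod w * s)).
  { induction N as [|N IH]; intros s Hs.
    - replace (Cexp (w * RtoC s) - psum exp_coef (w * RtoC s) 0)%C with (Cexp (w * RtoC s)) by (simpl; ring).
      rewrite Cmod_Cexp, re_scal_r. simpl. rewrite Rmult_1_l.
      assert (Re w * s <= 2 * Cmod w * s).
      { apply Rmult_le_compat_r; [exact Hs|]. generalize (re_le_Cmod w) (Rle_abs (Re w)) (Cmod_ge_0 w). lra. }
      destruct H as [H|H]; [apply Rlt_le, exp_increasing, H|rewrite H; lra].
    - set (f := fun x => (Cexp (w * RtoC x) - psum exp_coef (w * RtoC x) (S N))%C).
      assert (Hf0 : f 0 = 0).
      { unfold f. replace (w * 0)%C with (RtoC 0) by ring. rewrite Cexp_0.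
        assert (H0 : forall M, psum exp_coef 0 (S M) = 1).
        { induction M as [|M IHM].
          - simpl. unfold exp_coef. simpl. rewrite Rinv_1. ring.
          - change (psum exp_coef 0 (S M) + exp_coef (S M) * 0 ^ (S M) = 1)%C.
            rewrite IHM, Cpow_S. ring. }
        rewrite H0. ring. }
      assert (Hmv := mean_value_C f (fun x => w * (Cexp (w * RtoC x) - psum exp_coef (w * RtoC x) N))%C
        (fun x => (/ 2) ^ S N * exp (2 * Cmod w * x))
        (fun x => Cmod w * ((/ 2) ^ N * exp (2 * Cmod w * x))) 0 s Hs).
      rewrite Hf0 in Hmv. replace (f s - 0)%C with (f s) in Hmv by ring.
      eapply Rle_trans; [apply Hmv|].
      + intros t Ht.
        assert (Hid : is_derive (fun x : R => x) t 1) by apply (is_derive_id (K := R_AbsRing)).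
        evar_last; [apply Cderive_minus; [exact (Cderive_Cexp_comp (fun x => x) w t 1 Hid)|apply Cderive_psum_exp]|].
        simpl. ring.
      + intros t Ht. evar_last; [auto_derive; [easy|reflexivity]|]. simpl. field.
      + intros t Ht. rewrite Cmod_mult. apply Rmult_le_compat_l; [apply Cmod_ge_0|]. apply IH; lra.
      + assert (0 < (/ 2) ^ S N * exp (2 * Cmod w * 0)).
        { apply Rmult_lt_0_compat; [apply pow_lt; lra|apply exp_pos]. }
        lra. }
  specialize (K 1 Rle_0_1). replace (w * 1)%C with w in K by ring.
  now rewrite Rmult_1_r in K.
Qed.

(** Comes from [x <= exp x] applied to [eta * |ln t| / n] and raised to the
    power [n]. *)
Lemma ln_pow_bound (eta : R) (n : nat) : 0 < eta ->
  exists K, 0 < K /\ forall t, Rabs (ln t ^ n) <= K * exp (eta * Rabs (ln t)).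
Proof.
  intros He. destruct n as [|n].
  - exists 1. split; [lra|]. intros t. simpl. rewrite Rabs_R1.
    assert (0 <= eta * Rabs (ln t)) by (apply Rmult_le_pos; [lra|apply Rabs_pos]).
    generalize (exp_ineq1_le (eta * Rabs (ln t))). lra.
  - set (N := INR (S n)). assert (HN : 0 < N) by (apply lt_0_INR; lia).
    exists ((N / eta) ^ S n). split; [apply pow_lt, Rdiv_lt_0_compat; assumption|].
    intros t. rewrite <- RPow_abs.
    set (x := Rabs (ln t)). assert (Hx : 0 <= x) by apply Rabs_pos.
    replace (exp (eta * x)) with (exp (eta * x / N) ^ S n).
    + rewrite <- Rpow_mult_distr. apply pow_incr. split; [exact Hx|].
      replace x with (N / eta * (eta * x / N)) at 1 by (field; lra).
      apply Rmult_le_compat_l; [apply Rlt_le, Rdiv_lt_0_compat; assumption|].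
      generalize (exp_ineq1_le (eta * x / N)). lra.
    + assert (E : forall y m, exp y ^ m = exp (INR m * y)).
      { intros y m. induction m as [|m IH]; [simpl; rewrite Rmult_0_l, exp_0; reflexivity|].
        rewrite <- tech_pow_Rmult, IH, <- exp_plus, S_INR. f_equal. ring. }
      rewrite E. fold N. f_equal. field. lra.
Qed.

Lemma exp_le a b : a <= b -> exp a <= exp b.
Proof. intros [H|H]; [apply Rlt_le, exp_increasing, H|rewrite H; lra]. Qed.

(** * Complex power series *)

Definition Cpseries (c : nat -> C) (h v : C) : Prop :=
  is_pseries (K := C_AbsRing) (V := C_NormedModule) c h v.

Lemma psum_sum_n c h N :
  sum_n (fun k => scal (V := C_ModuleSpace) (pow_n (K := C_Ring) h k) (c k)) N = psum c h (S N).
Proof.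
  assert (Hp : forall k, pow_n (K := C_Ring) h k = (h ^ k)%C).
  { induction k as [|k IH]; [reflexivity|].
    change (h * pow_n (K := C_Ring) h k = h ^ S k)%C. now rewrite IH, Cpow_S. }
  induction N as [|N IH].
  - rewrite sum_O. change (pow_n (K := C_Ring) h 0 * c 0%nat = 0 + c 0%nat * h ^ 0)%C.
    rewrite Hp. ring.
  - rewrite sum_Sn, IH.
    change (psum c h (S N) + pow_n (K := C_Ring) h (S N) * c (S N) = psum c h (S N) + c (S N) * h ^ (S N))%C.
    rewrite Hp. ring.
Qed.

Lemma Cpseries_psum c h v : Cpseries c h v <-> Clim eventually (psum c h) v.
Proof.
  assert (E : Cpseries c h v <-> Clim eventually (fun N => psum c h (S N)) v).
  { split; intros H.
    - apply (filterlim_ext (F := eventually) (G := locally v) _ _ (psum_sum_n c h)). exact H.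
    - apply (filterlim_ext (F := eventually) (G := locally v) _ _ (fun N => eq_sym (psum_sum_n c h N))). exact H. }
  rewrite E. unfold Clim. rewrite !(filterlim_Cmod eventually).
  split; intros H eps He; destruct (H eps He) as [N HN].
  - exists (S N). intros [|m] Hm; [lia|]. apply HN. lia.
  - exists N. intros m Hm. apply HN. lia.
Qed.

Lemma Cpseries_unique c h v1 v2 : Cpseries c h v1 -> Cpseries c h v2 -> v1 = v2.
Proof. rewrite !Cpseries_psum. apply (Clim_unique eventually). Qed.

Lemma pow_half_small (B eps : R) : 0 < eps -> eventually (fun N => B * (/ 2) ^ N < eps).
Proof.
  intros He.
  assert (HB : 0 < Rabs B + 1) by (generalize (Rabs_pos B); lra).
  destruct (pow_lt_1_zero (/ 2) ltac:(rewrite Rabs_pos_eq; lra) (eps / (Rabs B + 1)) (Rdiv_lt_0_compat _ _ He HB)) as [N HN].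
  exists N. intros m Hm. specialize (HN m Hm).
  assert (Hp : 0 < (/ 2) ^ m) by (apply pow_lt; lra).
  rewrite Rabs_pos_eq in HN by lra.
  apply (Rmult_lt_compat_l (Rabs B + 1)) in HN; [|exact HB].
  replace ((Rabs B + 1) * (eps / (Rabs B + 1))) with eps in HN by (field; lra).
  generalize (Rle_abs B). nra.
Qed.

Lemma Cpseries_of_bound c h v B :
  (forall N, Cmod (v - psum c h N) <= B * (/ 2) ^ N) -> Cpseries c h v.
Proof.
  intros H. apply Cpseries_psum. apply (filterlim_Cmod eventually). intros eps He.
  generalize (pow_half_small B eps He). apply filter_imp. intros N HN.
  rewrite <- Cmod_opp. replace (- (psum c h N - v))%C with (v - psum c h N)%C by ring.
  generalize (H N). lra.
Qed.

Lemma Cpseries_terms_bounded c h v :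
  Cpseries c h v -> exists B, 0 < B /\ forall m, Cmod (c m) * Cmod h ^ m <= B.
Proof.
  intros H. apply Cpseries_psum in H.
  destruct (proj1 (filterlim_Cmod eventually _ _) H 1 Rlt_0_1) as [N HN].
  assert (Hfin : forall M, exists B, 0 < B /\ forall m, (m < M)%nat -> Cmod (c m) * Cmod h ^ m <= B).
  { induction M as [|M [B [HB IH]]].
    - exists 1. split; [lra|]. intros m Hm. lia.
    - exists (B + Cmod (c M) * Cmod h ^ M).
      assert (0 <= Cmod (c M) * Cmod h ^ M) by (apply Rmult_le_pos; [|apply pow_le]; apply Cmod_ge_0).
      split; [lra|]. intros m Hm. destruct (Nat.eq_dec m M) as [->|Hne]; [lra|].
      generalize (IH m ltac:(lia)). lra. }
  destruct (Hfin N) as [B [HB HBm]]. exists (B + 2). split; [lra|]. intros m.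
  destruct (Nat.lt_ge_cases m N) as [Hm|Hm]; [generalize (HBm m Hm); lra|].
  generalize (HN m Hm) (HN (S m) ltac:(lia)).
  intros H1 H2. rewrite <- Cmod_pow, <- Cmod_mult.
  replace (c m * h ^ m)%C with ((psum c h (S m) - v) - (psum c h m - v))%C by (simpl; ring).
  eapply Rle_trans; [apply Cmod_triangle|]. rewrite Cmod_opp. lra.
Qed.

(** The terms are dominated by a geometric series of ratio [|h| / R0 <= 1/2],
    hence the factor 2. *)
Lemma Cpseries_remainder c h v R0 B N :
  0 < R0 -> (forall m, Cmod (c m) * R0 ^ m <= B) -> Cmod h <= R0 / 2 ->
  Cpseries c h v -> Cmod (v - psum c h N) <= 2 * B * (Cmod h / R0) ^ N.
Proof.
  intros HR HB Hh Hv. apply Cpseries_psum in Hv.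
  set (q := Cmod h / R0).
  assert (Hq0 : 0 <= q) by (apply Rdiv_le_0_compat; [apply Cmod_ge_0|lra]).
  assert (Hq : q <= / 2).
  { unfold q. apply (Rmult_le_reg_r R0); [lra|]. replace (Cmod h / R0 * R0) with (Cmod h) by (field; lra). lra. }
  assert (HB0 : 0 <= B).
  { eapply Rle_trans; [|apply (HB 0%nat)]. simpl. rewrite Rmult_1_r. apply Cmod_ge_0. }
  assert (Hterm : forall m, Cmod (c m * h ^ m) <= B * q ^ m).
  { intros m. rewrite Cmod_mult, Cmod_pow. unfold q, Rdiv. rewrite Rpow_mult_distr, pow_inv.
    assert (Hp : 0 < R0 ^ m) by (apply pow_lt; lra).
    apply (Rmult_le_reg_r (R0 ^ m)); [exact Hp|].
    replace (B * (Cmod h ^ m * / R0 ^ m) * R0 ^ m) with (B * Cmod h ^ m) by (field; lra).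
    generalize (HB m) (pow_le (Cmod h) m (Cmod_ge_0 h)). nra. }
  assert (Hpart : forall M, Cmod (psum c h (M + N) - psum c h N) <= 2 * B * q ^ N * (1 - (/ 2) ^ M)).
  { induction M as [|M IH].
    - simpl. replace (psum c h N - psum c h N)%C with (RtoC 0) by ring. rewrite Cmod_0. lra.
    - replace (psum c h (S M + N) - psum c h N)%C
        with ((psum c h (M + N) - psum c h N) + c (M + N)%nat * h ^ (M + N))%C by (simpl; ring).
      eapply Rle_trans; [apply Cmod_triangle|].
      generalize (Hterm (M + N)%nat). rewrite pow_add.
      assert (HqM : q ^ M <= (/ 2) ^ M) by (apply pow_incr; lra).
      assert (HqN : 0 <= q ^ N) by (apply pow_le; lra).
      intros HT. simpl (/2 ^ S M).
      assert (B * (q ^ M * q ^ N) <= B * ((/ 2) ^ M * q ^ N)).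
      { apply Rmult_le_compat_l; [lra|]. apply Rmult_le_compat_r; lra. }
      rewrite <- (tech_pow_Rmult (/ 2) M).
      replace (2 * B * q ^ N * (1 - / 2 * (/ 2) ^ M)) with
        (2 * B * q ^ N * (1 - (/ 2) ^ M) + B * ((/ 2) ^ M * q ^ N)) by field.
      lra. }
  apply (Clim_le eventually (fun M => psum c h (M + N) - psum c h N)%C _ (fun _ => 2 * B * q ^ N)).
  - apply filter_forall. intros M. eapply Rle_trans; [apply Hpart|].
    assert (0 <= 2 * B * q ^ N) by (apply Rmult_le_pos; [lra|apply pow_le; lra]).
    assert (0 < (/ 2) ^ M) by (apply pow_lt; lra). nra.
  - apply (Clim_minus eventually); [|apply (Clim_const eventually)].
    intros P HP. destruct (Hv P HP) as [K HK]. exists K. intros m Hm. apply HK. lia.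
  - apply filterlim_const.
Qed.

Lemma psum_plus c d h N : psum (fun m => c m + d m)%C h N = (psum c h N + psum d h N)%C.
Proof. induction N as [|N IH]; simpl; [ring|rewrite IH; ring]. Qed.

Lemma psum_scal a c h N : psum (fun m => a * c m)%C h N = (a * psum c h N)%C.
Proof. induction N as [|N IH]; simpl; [ring|rewrite IH; ring]. Qed.

(** Coefficients of [(q + h)] times the series. *)
Definition affine_mult_coef (q : C) (c : nat -> C) (m : nat) : C :=
  (q * c m + match m with O => 0 | S k => c k end)%C.

Lemma psum_affine_mult q c h N :
  psum (affine_mult_coef q c) h (S N) = (q * psum c h (S N) + h * psum c h N)%C.
Proof.
  induction N as [|N IH].
  - simpl. unfold affine_mult_coef. ring.
  - change (psum (affine_mult_coef q c) h (S N) + affine_mult_coef q c (S N) * h ^ S N =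
      q * (psum c h (S N) + c (S N) * h ^ S N) + h * psum c h (S N))%C.
    rewrite IH. unfold affine_mult_coef. simpl psum. rewrite Cpow_S. ring.
Qed.

(** Coefficients of the quotient of the series by [q + h]: the recursion solves
    [q * b (m+1) + b m = c (m+1)]. *)
Fixpoint affine_div_coef (q : C) (c : nat -> C) (m : nat) : C :=
  match m with
  | O => (c 0%nat / q)%C
  | S k => ((c (S k) - affine_div_coef q c k) / q)%C
  end.

Lemma psum_affine_div (q : C) c h N : q <> 0 ->
  ((q + h) * psum (affine_div_coef q c) h (S N) =
  psum c h (S N) + affine_div_coef q c N * h ^ S N)%C.
Proof.
  intros Hq. induction N as [|N IH].
  - simpl. field. exact Hq.
  - change ((q + h) * (psum (affine_div_coef q c) h (S N) + affine_div_coef q c (S N) * h ^ S N) =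
      (psum c h (S N) + c (S N) * h ^ S N) + affine_div_coef q c (S N) * h ^ S (S N))%C.
    rewrite Cmult_plus_distr_l, IH. rewrite (Cpow_S h (S N)). simpl affine_div_coef. field. exact Hq.
Qed.

(** * Germs of analytic relations *)

(** The values of the functions to be continued are only known as limits, that
    is through a relation [P z v].  [germ P z0] says that near [z0] the relation
    has a solution given by a power series; stating it for relations avoids
    choosing the values before their existence and uniqueness are known. *)
Definition germ (P : C -> C -> Prop) (z0 : C) : Prop :=
  exists (c : nat -> C) (r : R), 0 < r /\
    forall h : C, Cmod h < r -> exists v : C, Cpseries c h v /\ P (z0 + h)%C v.

Lemma germ_imp (P Q : C -> C -> Prop) z0 rho :
  0 < rho -> (forall h v, Cmod h < rho -> P (z0 + h)%C v -> Q (z0 + h)%C v) -> germ P z0 -> germ Q z0.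
Proof.
  intros Hrho HPQ [c [r [Hr H]]]. exists c, (Rmin r rho). split; [now apply Rmin_glb_lt|].
  intros h Hh. destruct (H h) as [v [H1 H2]].
  - eapply Rlt_le_trans; [exact Hh|apply Rmin_l].
  - exists v. split; [exact H1|]. apply HPQ; [|exact H2].
    eapply Rlt_le_trans; [exact Hh|apply Rmin_r].
Qed.

Lemma germ_const a z0 : germ (fun _ v => v = a) z0.
Proof.
  exists (fun m => match m with O => a | S _ => 0 end), 1. split; [lra|].
  intros h _. exists a. split; [|reflexivity].
  apply Cpseries_psum. apply (filterlim_Cmod eventually). intros eps He. exists 1%nat.
  intros m Hm. replace (psum (fun m => match m with O => a | S _ => 0 end) h m - a)%C with (RtoC 0).
  - now rewrite Cmod_0.
  - destruct m as [|m]; [lia|]. clear Hm. induction m as [|m IH]; [simpl; ring|].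
    simpl in *. rewrite IH at 1. ring.
Qed.

Lemma germ_plus P Q z0 :
  germ P z0 -> germ Q z0 -> germ (fun z v => exists v1 v2, P z v1 /\ Q z v2 /\ v = (v1 + v2)%C) z0.
Proof.
  intros [c [r [Hr H]]] [d [s [Hs K]]].
  exists (fun m => c m + d m)%C, (Rmin r s). split; [now apply Rmin_glb_lt|].
  intros h Hh.
  destruct (H h) as [v1 [H1 H2]]; [eapply Rlt_le_trans; [exact Hh|apply Rmin_l]|].
  destruct (K h) as [v2 [K1 K2]]; [eapply Rlt_le_trans; [exact Hh|apply Rmin_r]|].
  exists (v1 + v2)%C. split; [|now exists v1, v2].
  apply Cpseries_psum. apply Cpseries_psum in H1, K1.
  apply (Clim_ext eventually (fun N => psum c h N + psum d h N)%C).
  - apply filter_forall. intros N. now rewrite psum_plus.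
  - now apply (Clim_plus eventually).
Qed.

Lemma germ_scal a P z0 :
  germ P z0 -> germ (fun z v => exists v1, P z v1 /\ v = (a * v1)%C) z0.
Proof.
  intros [c [r [Hr H]]].
  exists (fun m => a * c m)%C, r. split; [exact Hr|].
  intros h Hh. destruct (H h Hh) as [v1 [H1 H2]].
  exists (a * v1)%C. split; [|now exists v1].
  apply Cpseries_psum. apply Cpseries_psum in H1.
  apply (Clim_ext eventually (fun N => a * psum c h N)%C).
  - apply filter_forall. intros N. now rewrite psum_scal.
  - now apply (Clim_scal eventually).
Qed.

Lemma Clim_eventually_S (u : nat -> C) l : Clim eventually u l <-> Clim eventually (fun N => u (S N)) l.
Proof.
  unfold Clim. rewrite !(filterlim_Cmod eventually).
  split; intros H eps He; destruct (H eps He) as [N HN].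
  - exists N. intros m Hm. apply HN. lia.
  - exists (S N). intros [|m] Hm; [lia|]. apply HN. lia.
Qed.

Lemma germ_affine_mult b P z0 :
  germ P z0 -> germ (fun z v => exists v1, P z v1 /\ v = ((z - b) * v1)%C) z0.
Proof.
  intros [c [r [Hr H]]].
  exists (affine_mult_coef (z0 - b) c), r. split; [exact Hr|].
  intros h Hh. destruct (H h Hh) as [v1 [H1 H2]].
  exists ((z0 + h - b) * v1)%C. split; [|now exists v1].
  apply Cpseries_psum. apply Cpseries_psum in H1.
  apply Clim_eventually_S.
  apply (Clim_ext eventually (fun N => (z0 - b) * psum c h (S N) + h * psum c h N)%C).
  - apply filter_forall. intros N. now rewrite psum_affine_mult.
  - replace ((z0 + h - b) * v1)%C with ((z0 - b) * v1 + h * v1)%C by ring.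
    apply (Clim_plus eventually); apply (Clim_scal eventually); [|exact H1].
    now apply Clim_eventually_S in H1.
Qed.

(** If the terms of the series are at most [B] in a disc of radius [s] with
    [s <= |q| / 2], the recursion for the quotient gives the bound
    [B / |q| + K / 2], which is at most [K] for [K = 2 B / |q|]; hence the
    boundary term of the telescoping identity [psum_affine_div] tends to 0 in the
    disc of radius [s / 2]. *)
Lemma germ_affine_div (b : C) P (z0 : C) : z0 <> b ->
  germ P z0 -> germ (fun z v => exists v1, P z v1 /\ v = (v1 / (z - b))%C) z0.
Proof.
  intros Hb [c [r [Hr H]]].
  set (q := (z0 - b)%C).
  assert (Hq : q <> 0) by now apply Cminus_eq_contra.
  assert (Hqm : 0 < Cmod q) by now apply Cmod_gt_0.
  destruct (H (RtoC (r / 2))) as [w [Hw _]].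
  { rewrite Cmod_R, Rabs_pos_eq; lra. }
  destruct (Cpseries_terms_bounded _ _ _ Hw) as [B [HB HBm]].
  rewrite Cmod_R, Rabs_pos_eq in HBm by lra.
  (* The radius must stay below the distance to the zero of the denominator. *)
  set (s := Rmin (r / 2) (Cmod q / 2)).
  assert (Hs : 0 < s) by (apply Rmin_glb_lt; lra).
  assert (Hsr : s <= r / 2) by apply Rmin_l.
  assert (Hsq : s <= Cmod q / 2) by apply Rmin_r.
  set (K := 2 * B / Cmod q).
  assert (HK : 0 < K) by (apply Rdiv_lt_0_compat; lra).
  assert (HcB : forall m, Cmod (c m) * s ^ m <= B).
  { intros m. eapply Rle_trans; [|apply (HBm m)]. apply Rmult_le_compat_l; [apply Cmod_ge_0|].
    apply pow_incr; lra. }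
  assert (HBK : B / Cmod q = K / 2) by (unfold K; field; lra).
  assert (Hdiv : forall m, Cmod (affine_div_coef q c m) * s ^ m <= K).
  { induction m as [|m IH].
    - simpl. rewrite Cmod_div by exact Hq. generalize (HcB 0%nat). simpl. intros H0.
      assert (Cmod (c 0%nat) / Cmod q <= B / Cmod q).
      { apply Rmult_le_compat_r; [apply Rlt_le, Rinv_0_lt_compat; lra|lra]. }
      lra.
    - simpl affine_div_coef. rewrite Cmod_div by exact Hq.
      assert (Htri : Cmod (c (S m) - affine_div_coef q c m) <= Cmod (c (S m)) + Cmod (affine_div_coef q c m)).
      { eapply Rle_trans; [apply Cmod_triangle|]. rewrite Cmod_opp. lra. }
      assert (Hp : 0 < s ^ S m) by (apply pow_lt; lra).
      apply Rle_trans with ((Cmod (c (S m)) + Cmod (affine_div_coef q c m)) * s ^ S m / Cmod q).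
      + replace (Cmod (c (S m) - affine_div_coef q c m) / Cmod q * s ^ S m)
          with (Cmod (c (S m) - affine_div_coef q c m) * s ^ S m / Cmod q) by (field; lra).
        apply Rmult_le_compat_r; [apply Rlt_le, Rinv_0_lt_compat; lra|].
        apply Rmult_le_compat_r; lra.
      + replace ((Cmod (c (S m)) + Cmod (affine_div_coef q c m)) * s ^ S m / Cmod q)
          with ((Cmod (c (S m)) * s ^ S m) / Cmod q + (Cmod (affine_div_coef q c m) * s ^ m) * (s / Cmod q))
          by (simpl; field; lra).
        assert (Cmod (c (S m)) * s ^ S m / Cmod q <= B / Cmod q).
        { apply Rmult_le_compat_r; [apply Rlt_le, Rinv_0_lt_compat; lra|apply HcB]. }
        assert (Hsq2 : s / Cmod q <= / 2).
        { apply (Rmult_le_reg_r (Cmod q)); [lra|]. replace (s / Cmod q * Cmod q) with s by (field; lra). lra. }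
        assert (0 <= s / Cmod q) by (apply Rdiv_le_0_compat; lra).
        assert (0 <= Cmod (affine_div_coef q c m) * s ^ m).
        { apply Rmult_le_pos; [apply Cmod_ge_0|apply pow_le; lra]. }
        nra. }
  exists (affine_div_coef q c), (s / 2). split; [lra|].
  intros h Hh. destruct (H h ltac:(lra)) as [v1 [H1 H2]].
  exists (v1 / (z0 + h - b))%C. split; [|now exists v1].
  assert (Hqh : (q + h)%C <> 0).
  { intros E. assert (q = - h)%C by (rewrite <- (Cplus_0_l (- h)), <- E; ring).
    assert (Cmod q = Cmod h) by (rewrite H0; apply Cmod_opp). lra. }
  replace (z0 + h - b)%C with (q + h)%C by (unfold q; ring).
  apply Cpseries_psum. apply Cpseries_psum in H1.
  apply Clim_eventually_S. apply Clim_eventually_S in H1.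
  apply (Clim_ext eventually (fun N => / (q + h) * (psum c h (S N) + affine_div_coef q c N * h ^ S N))%C).
  - apply filter_forall. intros N. rewrite <- psum_affine_div by exact Hq. field. exact Hqh.
  - replace (v1 / (q + h))%C with (/ (q + h) * (v1 + 0))%C by (field; exact Hqh).
    apply (Clim_scal eventually), (Clim_plus eventually); [exact H1|].
    apply (filterlim_Cmod eventually). intros eps He.
    generalize (pow_half_small (K * s) eps He). apply filter_imp. intros N HN.
    replace (affine_div_coef q c N * h ^ S N - 0)%C with (affine_div_coef q c N * h ^ S N)%C by ring.
    rewrite Cmod_mult, Cmod_pow. eapply Rle_lt_trans; [|exact HN].
    apply Rle_trans with (Cmod (affine_div_coef q c N) * (s / 2) ^ S N).
    + apply Rmult_le_compat_l; [apply Cmod_ge_0|]. apply pow_incr. split; [apply Cmod_ge_0|lra].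
    + unfold Rdiv. rewrite Rpow_mult_distr. simpl.
      assert (0 < (/ 2) ^ N) by (apply pow_lt; lra).
      replace (Cmod (affine_div_coef q c N) * (s * s ^ N * (/ 2 * (/ 2) ^ N)))
        with (Cmod (affine_div_coef q c N) * s ^ N * (s * (/ 2) ^ N) * / 2) by ring.
      assert (0 < s * (/ 2) ^ N) by (apply Rmult_lt_0_compat; lra).
      generalize (Hdiv N). assert (0 <= Cmod (affine_div_coef q c N) * s ^ N).
      { apply Rmult_le_pos; [apply Cmod_ge_0|apply pow_le; lra]. }
      nra.
Qed.

Lemma analytic_germ f z0 : analytic_at f z0 <-> germ (fun z v => v = f z) z0.
Proof.
  split.
  - intros [c Hc]. apply locally_Cmod in Hc. destruct Hc as [r [Hr H]].
    exists c, r. split; [exact Hr|]. intros h Hh. exists (f (z0 + h)%C). split; [|reflexivity].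
    specialize (H (z0 + h)%C). replace (z0 + h - z0)%C with h in H by ring. now apply H.
  - intros [c [r [Hr H]]]. exists c. apply locally_Cmod. exists r. split; [exact Hr|].
    intros z Hz. destruct (H _ Hz) as [v [H1 H2]].
    replace (z0 + (z - z0))%C with z in H2 by ring. rewrite <- H2. exact H1.
Qed.

Lemma analytic_minus f g z0 :
  analytic_at f z0 -> analytic_at g z0 -> analytic_at (fun z => f z - g z)%C z0.
Proof.
  rewrite !analytic_germ. intros Hf Hg.
  generalize (germ_plus _ _ _ Hf (germ_scal (-1) _ _ Hg)).
  apply (germ_imp _ _ z0 1 Rlt_0_1). intros h v _ [v1 [v2 [H1 [[v3 [H3 H2]] ->]]]].
  rewrite H1, H2, H3. ring.
Qed.

(** * The identity theorem *)

(** At the first nonzero coefficient [c m] the remainder estimate gives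
    [|c m| = O(|h|)] along the zeros [h] tending to 0. *)
Lemma pseries_zero_accum c r f :
  0 < r -> (forall h, Cmod h < r -> Cpseries c h (f h)) ->
  (forall eps, 0 < eps -> exists h, 0 < Cmod h < eps /\ f h = 0) ->
  forall h, Cmod h < r -> f h = 0.
Proof.
  intros Hr H Hacc.
  assert (Hc : forall m, c m = 0).
  { intros m. induction m as [m IH] using (well_founded_induction PeanoNat.Nat.lt_wf_0).
    destruct (classic (c m = 0)) as [E|E]; [exact E|exfalso].
    apply Cmod_gt_0 in E.
    assert (Hw := H (RtoC (r / 2)) ltac:(rewrite Cmod_R, Rabs_pos_eq; lra)).
    destruct (Cpseries_terms_bounded _ _ _ Hw) as [B [HB HBm]].
    rewrite Cmod_R, Rabs_pos_eq in HBm by lra.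
    set (R0 := r / 2) in *. assert (HR : 0 < R0) by (unfold R0; lra).
    assert (HRp : 0 < R0 ^ S m) by (apply pow_lt; lra).
    set (eps := Rmin (R0 / 2) (Cmod (c m) * R0 ^ S m / (2 * B))).
    assert (Heps : 0 < eps).
    { apply Rmin_glb_lt; [lra|]. apply Rdiv_lt_0_compat; [|lra]. apply Rmult_lt_0_compat; lra. }
    destruct (Hacc eps Heps) as [h [[Hh0 Hh] Hfh]].
    assert (Hh1 : Cmod h < R0 / 2) by (eapply Rlt_le_trans; [exact Hh|apply Rmin_l]).
    assert (Hh2 : Cmod h < Cmod (c m) * R0 ^ S m / (2 * B)) by (eapply Rlt_le_trans; [exact Hh|apply Rmin_r]).
    assert (Hrem := Cpseries_remainder c h (f h) R0 B (S m) HR HBm ltac:(lra) (H h ltac:(unfold R0 in *; lra))).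
    assert (Hps : psum c h m = 0).
    { assert (K : forall j, (j <= m)%nat -> psum c h j = 0).
      { induction j as [|j IHj]; intros Hj; [reflexivity|].
        simpl. rewrite IHj by lia. rewrite (IH j) by lia. ring. }
      apply K; lia. }
    simpl psum in Hrem. rewrite Hfh, Hps in Hrem.
    replace (0 - (0 + c m * h ^ m))%C with (- (c m * h ^ m))%C in Hrem by ring.
    rewrite Cmod_opp, Cmod_mult, Cmod_pow in Hrem.
    unfold Rdiv in Hrem. rewrite Rpow_mult_distr, pow_inv in Hrem.
    assert (Hhm : 0 < Cmod h ^ m) by (apply pow_lt; lra).
    apply (Rmult_lt_compat_r (2 * B)) in Hh2; [|lra].
    replace (Cmod (c m) * R0 ^ S m / (2 * B) * (2 * B)) with (Cmod (c m) * R0 ^ S m) in Hh2 by (field; lra).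
    apply (Rmult_le_compat_r (R0 ^ S m)) in Hrem; [|lra].
    replace (2 * B * (Cmod h ^ S m * / R0 ^ S m) * R0 ^ S m) with (2 * B * Cmod h * Cmod h ^ m) in Hrem
      by (simpl; field; split; [apply pow_nonzero|]; lra).
    assert (Cmod h * (2 * B) * Cmod h ^ m < Cmod (c m) * R0 ^ S m * Cmod h ^ m).
    { apply Rmult_lt_compat_r; assumption. }
    lra. }
  intros h Hh. apply (Cpseries_unique c h _ _ (H h Hh)).
  apply (Cpseries_of_bound c h 0 0). intros N.
  assert (E : psum c h N = 0) by (induction N as [|N IH]; [reflexivity|simpl; rewrite IH, Hc; ring]).
  rewrite E. replace (0 - 0)%C with (RtoC 0) by ring. rewrite Cmod_0. lra.
Qed.

Lemma analytic_zero_accum f z0 :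
  analytic_at f z0 ->
  (forall eps, 0 < eps -> exists z, 0 < Cmod (z - z0) < eps /\ f z = 0) ->
  locally z0 (fun z => f z = 0).
Proof.
  intros [c Hc] Hacc. apply locally_Cmod in Hc. destruct Hc as [r [Hr H]].
  apply locally_Cmod. exists r. split; [exact Hr|]. intros z Hz.
  replace z with (z0 + (z - z0))%C by ring.
  apply (pseries_zero_accum c r (fun h => f (z0 + h)%C) Hr).
  - intros h Hh. specialize (H (z0 + h)%C). replace (z0 + h - z0)%C with h in H by ring. now apply H.
  - intros eps He. destruct (Hacc eps He) as [w [Hw Hfw]]. exists (w - z0)%C.
    split; [exact Hw|]. now replace (z0 + (w - z0))%C with w by ring.
  - exact Hz.
Qed.

(** Connectedness of the segment, through the supremum of the [s] such that [Q]
    holds on the whole of [0, s]. *)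
Lemma segment_induction (Q : R -> Prop) :
  Q 0 ->
  (forall s, 0 <= s < 1 -> Q s -> exists delta, 0 < delta /\ forall s', s < s' < s + delta -> Q s') ->
  (forall s, 0 < s <= 1 -> (forall s', 0 <= s' < s -> Q s') -> Q s) ->
  Q 1.
Proof.
  intros Q0 Hop Hcl.
  set (E := fun s => 0 <= s <= 1 /\ forall s', 0 <= s' <= s -> Q s').
  destruct (completeness E) as [m [Hub Hlub]].
  - exists 1. intros s [Hs _]. lra.
  - exists 0. split; [lra|]. intros s' Hs'. now replace s' with 0 by lra.
  - assert (Hm0 : 0 <= m) by (apply Hub; split; [lra|]; intros s' Hs'; now replace s' with 0 by lra).
    assert (Hm1 : m <= 1) by (apply Hlub; intros s [Hs _]; lra).
    assert (Hbelow : forall s', 0 <= s' < m -> Q s').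
    { intros s' Hs'. destruct (classic (exists s, E s /\ s' < s)) as [[s [Es Hs]]|Hn].
      - apply Es; lra.
      - exfalso. assert (m <= s'); [|lra]. apply Hlub. intros s Es.
        destruct (Rle_or_lt s s') as [H|H]; [exact H|]. exfalso. apply Hn. now exists s. }
    assert (Qm : Q m).
    { destruct (Req_dec m 0) as [E0|E0]; [now rewrite E0|]. apply Hcl; [lra|exact Hbelow]. }
    destruct (Rle_lt_or_eq_dec m 1 Hm1) as [Hlt|Heq]; [|now rewrite <- Heq].
    exfalso. destruct (Hop m ltac:(lra) Qm) as [delta [Hd Hdel]].
    set (s := Rmin (m + delta / 2) 1).
    assert (Hs : m < s) by (apply Rmin_glb_lt; lra).
    assert (s <= m + delta / 2) by apply Rmin_l. assert (s <= 1) by apply Rmin_r.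
    assert (Es : E s).
    { split; [lra|]. intros s' Hs'. destruct (Rlt_or_le s' m); [apply Hbelow; lra|].
      destruct (Req_dec s' m) as [->|]; [exact Qm|]. apply Hdel. lra. }
    generalize (Hub s Es). lra.
Qed.

Lemma locally_of_near (P : C -> Prop) z r w :
  (forall u, Cmod (u - z) < r -> P u) -> Cmod (w - z) < r -> locally w P.
Proof.
  intros H Hw. apply locally_Cmod. exists (r - Cmod (w - z)). split; [lra|].
  intros u Hu. apply H. replace (u - z)%C with ((u - w) + (w - z))%C by ring.
  eapply Rle_lt_trans; [apply Cmod_triangle|]. lra.
Qed.

Definition seg (z0 z1 : C) (s : R) : C := (z0 + RtoC s * (z1 - z0))%C.

Lemma Cmod_seg z0 z1 s s' : Cmod (seg z0 z1 s' - seg z0 z1 s) = Rabs (s' - s) * Cmod (z1 - z0).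
Proof.
  unfold seg. replace (z0 + s' * (z1 - z0) - (z0 + s * (z1 - z0)))%C with (RtoC (s' - s) * (z1 - z0))%C.
  - now rewrite Cmod_mult, Cmod_R.
  - rewrite RtoC_minus. ring.
Qed.

Lemma analytic_zero_segment f z0 z1 :
  (forall s, 0 <= s <= 1 -> analytic_at f (seg z0 z1 s)) ->
  locally z0 (fun z => f z = 0) -> locally z1 (fun z => f z = 0).
Proof.
  intros Han H0.
  destruct (classic (z1 = z0)) as [->|Hne]; [exact H0|].
  assert (HD : 0 < Cmod (z1 - z0)) by now apply Cmod_gt_0, Cminus_eq_contra.
  set (D := Cmod (z1 - z0)) in *.
  replace z1 with (seg z0 z1 1) by (unfold seg; ring).
  apply (segment_induction (fun s => locally (seg z0 z1 s) (fun z => f z = 0))).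
  - replace (seg z0 z1 0) with z0 by (unfold seg; ring). exact H0.
  - intros s Hs Qs. apply locally_Cmod in Qs. destruct Qs as [r [Hr Q]].
    exists (r / D). split; [now apply Rdiv_lt_0_compat|]. intros s' Hs'.
    apply (locally_of_near _ (seg z0 z1 s) r); [exact Q|].
    rewrite Cmod_seg. fold D. rewrite Rabs_pos_eq by lra.
    apply Rlt_le_trans with (r / D * D); [apply Rmult_lt_compat_r; lra|right; field; lra].
  - intros s Hs Q. apply analytic_zero_accum; [apply Han; lra|].
    intros eps He. set (e := Rmin s (eps / D) / 2).
    assert (He0 : 0 < Rmin s (eps / D)) by (apply Rmin_glb_lt; [lra|now apply Rdiv_lt_0_compat]).
    assert (He1 : Rmin s (eps / D) <= s) by apply Rmin_l.
    assert (He2 : Rmin s (eps / D) <= eps / D) by apply Rmin_r.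
    exists (seg z0 z1 (s - e)). split.
    + rewrite Cmod_seg. fold D. replace (s - e - s) with (- e) by ring. rewrite Rabs_Ropp, Rabs_pos_eq by (unfold e; lra).
      split; [apply Rmult_lt_0_compat; unfold e; lra|].
      apply Rlt_le_trans with (eps / D * D); [apply Rmult_lt_compat_r; unfold e; lra|right; field; lra].
    + exact (locally_singleton _ _ (Q (s - e) ltac:(unfold e; lra))).
Qed.

Lemma Cmod_seg_lt x y s r : 0 <= s <= 1 -> Cmod x < r -> Cmod y < r -> Cmod (seg x y s) < r.
Proof.
  intros Hs Hx Hy. unfold seg.
  replace (x + s * (y - x))%C with (RtoC (1 - s) * x + RtoC s * y)%C by (rewrite RtoC_minus; ring).
  eapply Rle_lt_trans; [apply Cmod_triangle|].
  rewrite !Cmod_mult, !Cmod_R, !Rabs_pos_eq by lra.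
  destruct (Req_dec s 0) as [->|]; [lra|].
  assert (s * Cmod y < s * r) by (apply Rmult_lt_compat_l; lra).
  assert ((1 - s) * Cmod x <= (1 - s) * r) by (apply Rmult_le_compat_l; lra).
  lra.
Qed.

(** A punctured disc is connected: two points are joined by a segment unless the
    segment meets the centre, and then [u - z0] is a negative multiple of
    [w - z0], so that the detour through [Ci * (w - z0)] avoids the centre. *)
Lemma analytic_zero_punctured f z0 r w u :
  (forall z, z <> z0 -> Cmod (z - z0) < r -> analytic_at f z) ->
  w <> z0 -> Cmod (w - z0) < r -> u <> z0 -> Cmod (u - z0) < r ->
  locally w (fun z => f z = 0) -> locally u (fun z => f z = 0).
Proof.
  intros Han.
  assert (Hdir : forall x y, Cmod x < r -> Cmod y < r ->
    (forall s, 0 <= s <= 1 -> seg x y s <> 0) ->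
    locally (z0 + x)%C (fun z => f z = 0) -> locally (z0 + y)%C (fun z => f z = 0)).
  { intros x y Hx Hy Hs. apply analytic_zero_segment. intros s Hs01.
    replace (seg (z0 + x) (z0 + y) s) with (z0 + seg x y s)%C by (unfold seg; ring).
    apply Han.
    - intros E. apply (Hs s Hs01).
      replace (seg x y s) with ((z0 + seg x y s) - z0)%C by ring. rewrite E. ring.
    - replace (z0 + seg x y s - z0)%C with (seg x y s) by ring. now apply Cmod_seg_lt. }
  intros Hw Hwr Hu Hur.
  set (x := (w - z0)%C) in *. set (y := (u - z0)%C) in *.
  assert (Hx : x <> 0) by now apply Cminus_eq_contra.
  assert (Hy : y <> 0) by now apply Cminus_eq_contra.
  replace w with (z0 + x)%C by (unfold x; ring). replace u with (z0 + y)%C by (unfold y; ring).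
  destruct (classic (exists s, 0 <= s <= 1 /\ seg x y s = 0)) as [[s [Hs E]]|Hn].
  - assert (Hrot : forall a b : R, (a <> 0 \/ b <> 0) -> (x * (RtoC a + RtoC b * Ci) <> 0)%C).
    { intros a b Hab. apply Cmult_neq_0; [exact Hx|]. intros E'.
      apply (f_equal (fun z => (Re z, Im z))) in E'. unfold Re, Im, Ci in E'. simpl in E'.
      injection E' as E1 E2. lra. }
    assert (Hs0 : s <> 0).
    { intros ->. apply Hx. rewrite <- E. unfold seg. ring. }
    assert (HsC : RtoC s <> 0) by (intros F; apply RtoC_inj in F; lra).
    assert (Ey : y = (x * RtoC (- ((1 - s) / s)))%C).
    { rewrite RtoC_opp, RtoC_div, RtoC_minus by exact Hs0.
      assert (E' : (RtoC s * y = - (1 - RtoC s) * x)%C).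
      { unfold seg in E. replace (RtoC s * y)%C with (x + s * (y - x) - (1 - RtoC s) * x)%C by ring.
        rewrite E. ring. }
      replace y with (RtoC s * y / RtoC s)%C by (field; exact HsC). rewrite E'. field. exact HsC. }
    intros Hlw.
    assert (Hmid : Cmod (x * Ci) < r) by (rewrite Cmod_mult, Cmod_Ci, Rmult_1_r; exact Hwr).
    apply (Hdir (x * Ci)%C y Hmid Hur).
    + intros t Ht. rewrite Ey. unfold seg.
      replace (x * Ci + t * (x * RtoC (- ((1 - s) / s)) - x * Ci))%C
        with (x * (RtoC (t * - ((1 - s) / s)) + RtoC (1 - t) * Ci))%C
        by (rewrite RtoC_mult, RtoC_minus; ring).
      apply Hrot. destruct (Req_dec t 1) as [->|]; [left|right; lra].
      rewrite Rmult_1_l. intros E1. apply Hy. rewrite Ey, E1. ring.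
    + apply (Hdir x (x * Ci)%C Hwr Hmid); [|exact Hlw].
      intros t Ht. unfold seg.
      replace (x + t * (x * Ci - x))%C with (x * (RtoC (1 - t) + RtoC t * Ci))%C by (rewrite RtoC_minus; ring).
      apply Hrot. lra.
  - apply Hdir; try assumption. intros s Hs E. apply Hn. now exists s.
Qed.

(** Isolated singularities may lie on the segment, so the property propagated
    along it is vanishing on a punctured neighbourhood; passing to the limit point
    uses the connectedness of punctured discs. *)
Lemma identity_theorem f z0 z1 :
  (forall s, 0 <= s <= 1 -> locally' (seg z0 z1 s) (analytic_at f)) ->
  locally z0 (fun z => f z = 0) -> analytic_at f z1 -> f z1 = 0.
Proof.
  intros Han H0 Hz1.
  destruct (classic (z1 = z0)) as [->|Hne]; [exact (locally_singleton _ _ H0)|].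
  assert (HD : 0 < Cmod (z1 - z0)) by now apply Cmod_gt_0, Cminus_eq_contra.
  set (D := Cmod (z1 - z0)) in *.
  assert (Hneq : forall s s', s <> s' -> seg z0 z1 s <> seg z0 z1 s').
  { intros s s' Hs E. assert (K := Cmod_seg z0 z1 s s'). rewrite E in K.
    replace (seg z0 z1 s' - seg z0 z1 s')%C with (RtoC 0) in K by ring. rewrite Cmod_0 in K. fold D in K.
    assert (0 < Rabs (s' - s)) by (apply Rabs_pos_lt; lra). nra. }
  assert (Q1 : locally' (seg z0 z1 1) (fun z => f z = 0)).
  { apply (segment_induction (fun s => locally' (seg z0 z1 s) (fun z => f z = 0))).
    - replace (seg z0 z1 0) with z0 by (unfold seg; ring).
      unfold locally', within. apply (filter_imp (F := locally z0) (fun z => f z = 0)); [|exact H0].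
      intros z Hz _. exact Hz.
    - intros s Hs Qs. apply locally_Cmod in Qs. destruct Qs as [r [Hr Q]].
      exists (r / D). split; [now apply Rdiv_lt_0_compat|]. intros s' Hs'.
      assert (Hd : Cmod (seg z0 z1 s' - seg z0 z1 s) < r).
      { rewrite Cmod_seg. fold D. rewrite Rabs_pos_eq by lra.
        apply Rlt_le_trans with (r / D * D); [apply Rmult_lt_compat_r; lra|right; field; lra]. }
      assert (Hd0 : 0 < Cmod (seg z0 z1 s' - seg z0 z1 s)).
      { apply Cmod_gt_0, Cminus_eq_contra, Hneq. lra. }
      apply locally_Cmod.
      exists (Rmin (r - Cmod (seg z0 z1 s' - seg z0 z1 s)) (Cmod (seg z0 z1 s' - seg z0 z1 s))).
      split; [apply Rmin_glb_lt; lra|]. intros z Hz _. apply Q.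
      + replace (z - seg z0 z1 s)%C with ((z - seg z0 z1 s') + (seg z0 z1 s' - seg z0 z1 s))%C by ring.
        eapply Rle_lt_trans; [apply Cmod_triangle|]. eapply Rlt_le_trans in Hz; [|apply Rmin_l]. lra.
      + intros E. rewrite E in Hz. eapply Rlt_le_trans in Hz; [|apply Rmin_r].
        rewrite <- Cmod_opp in Hz.
        replace (- (seg z0 z1 s - seg z0 z1 s'))%C with (seg z0 z1 s' - seg z0 z1 s)%C in Hz by ring. lra.
    - intros s Hs Q. assert (Hs' := Han s ltac:(lra)). apply locally_Cmod in Hs'.
      destruct Hs' as [r [Hr HA]].
      set (s' := s - Rmin s (r / D) / 2).
      assert (He0 : 0 < Rmin s (r / D)) by (apply Rmin_glb_lt; [lra|now apply Rdiv_lt_0_compat]).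
      assert (He1 : Rmin s (r / D) <= s) by apply Rmin_l.
      assert (He2 : Rmin s (r / D) <= r / D) by apply Rmin_r.
      assert (Qs' := Q s' ltac:(unfold s'; lra)). apply locally_Cmod in Qs'.
      destruct Qs' as [q [Hq HQ]].
      set (p := seg z0 z1 s) in *. set (p' := seg z0 z1 s') in *.
      assert (Hpp : Cmod (p' - p) < r).
      { unfold p, p'. rewrite Cmod_seg. fold D. rewrite Rabs_left1 by (unfold s'; lra).
        apply Rlt_le_trans with (r / D * D); [apply Rmult_lt_compat_r; unfold s'; lra|right; field; lra]. }
      assert (Hpp0 : 0 < Cmod (p' - p)).
      { apply Cmod_gt_0, Cminus_eq_contra, Hneq. unfold s'. lra. }
      set (e := Rmin q (Rmin (r - Cmod (p' - p)) (Cmod (p' - p))) / 4).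
      assert (He : 0 < e).
      { unfold e. assert (0 < Rmin q (Rmin (r - Cmod (p' - p)) (Cmod (p' - p)))); [|lra].
        repeat apply Rmin_glb_lt; lra. }
      assert (Hb1 : 4 * e <= q) by (unfold e; generalize (Rmin_l q (Rmin (r - Cmod (p' - p)) (Cmod (p' - p)))); lra).
      assert (Hb2 : 4 * e <= Rmin (r - Cmod (p' - p)) (Cmod (p' - p))) by (unfold e; generalize (Rmin_r q (Rmin (r - Cmod (p' - p)) (Cmod (p' - p)))); lra).
      assert (Hb3 := Rmin_l (r - Cmod (p' - p)) (Cmod (p' - p))).
      assert (Hb4 := Rmin_r (r - Cmod (p' - p)) (Cmod (p' - p))).
      (* [f] may be singular at [p'] itself, hence the small shift. *)
      set (w := (p' + RtoC (2 * e))%C).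
      assert (Hwp : Cmod (w - p') = 2 * e).
      { unfold w. replace (p' + RtoC (2 * e) - p')%C with (RtoC (2 * e)) by ring.
        rewrite Cmod_R, Rabs_pos_eq; lra. }
      assert (Hw1 : w <> p).
      { intros E. rewrite E in Hwp. rewrite <- Cmod_opp in Hwp.
        replace (- (p - p'))%C with (p' - p)%C in Hwp by ring. lra. }
      assert (Hw2 : Cmod (w - p) < r).
      { replace (w - p)%C with ((w - p') + (p' - p))%C by ring.
        eapply Rle_lt_trans; [apply Cmod_triangle|]. lra. }
      assert (Hlw : locally w (fun z => f z = 0)).
      { apply locally_Cmod. exists e. split; [exact He|]. intros z Hz. apply HQ.
        - replace (z - p')%C with ((z - w) + (w - p'))%C by ring.
          eapply Rle_lt_trans; [apply Cmod_triangle|]. lra.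
        - intros E. rewrite E in Hz. rewrite <- Cmod_opp in Hz.
          replace (- (p' - w))%C with (w - p')%C in Hz by ring. lra. }
      apply locally_Cmod. exists r. split; [exact Hr|]. intros u Hu Hup.
      apply (locally_singleton u (fun z => f z = 0)).
      apply (analytic_zero_punctured f p r w u); try assumption.
      intros z Hz1' Hz2'. now apply HA. }
  replace (seg z0 z1 1) with z1 in Q1 by (unfold seg; ring).
  apply locally_Cmod in Q1. destruct Q1 as [r [Hr Q]].
  apply (locally_singleton z1 (fun z => f z = 0)).
  apply analytic_zero_accum; [exact Hz1|].
  intros eps He. set (e := Rmin r eps / 2).
  assert (0 < Rmin r eps) by (apply Rmin_glb_lt; lra).
  assert (He1 := Rmin_l r eps). assert (He2 := Rmin_r r eps).
  assert (Hm : Cmod (z1 + RtoC e - z1) = e).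
  { replace (z1 + RtoC e - z1)%C with (RtoC e) by ring. rewrite Cmod_R, Rabs_pos_eq; unfold e; lra. }
  exists (z1 + RtoC e)%C. rewrite Hm. split; [unfold e; lra|].
  apply Q.
  - rewrite Hm. unfold e; lra.
  - intros E. rewrite E in Hm. replace (z1 - z1)%C with (RtoC 0) in Hm by ring.
    rewrite Cmod_0 in Hm. unfold e in Hm. lra.
Qed.

(** * Primitives on the open interval from 0 to a *)

Definition dom (a : Rbar) (t : R) : Prop := 0 < t /\ Rbar_lt t a.

Lemma dom_locally a t : dom a t -> locally t (dom a).
Proof.
  intros [H1 H2]. apply filter_and.
  - apply (open_gt 0). exact H1.
  - destruct a as [a| |]; simpl in *; [apply (open_lt a); exact H2| |contradiction].
    now apply filter_forall.
Qed.

Lemma dom_convex a : convex (dom a).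
Proof.
  intros x y t [Hx1 Hx2] [Hy1 Hy2] Ht. split; [lra|].
  destruct a as [a| |]; simpl in *; try easy. lra.
Qed.

Lemma dom_inhabited a : Rbar_lt 0 a -> exists x0, dom a x0.
Proof.
  intros Ha. destruct a as [a| |]; simpl in Ha.
  - exists (a / 2). split; simpl; lra.
  - exists 1. split; simpl; [lra|easy].
  - contradiction.
Qed.

Definition is_primitive (a : Rbar) (Phi f : R -> C) : Prop :=
  forall t, dom a t -> Cderive Phi t (f t).

Lemma ex_primitive a f : Rbar_lt 0 a ->
  (forall t, dom a t -> continuous f t) -> exists Phi, is_primitive a Phi f.
Proof.
  intros Ha Hf. destruct (dom_inhabited a Ha) as [x0 Hx0].
  exists (fun b => RInt (V := C_R_CompleteNormedModule) f x0 b). intros t Ht.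
  apply (is_derive_RInt (V := C_R_CompleteNormedModule) f _ x0 t); [|now apply Hf].
  generalize (dom_locally a t Ht). apply filter_imp. intros b Hb.
  apply (RInt_correct (V := C_R_CompleteNormedModule)).
  apply (ex_RInt_continuous (V := C_R_CompleteNormedModule)).
  intros z Hz. apply Hf. now apply (convex_between (dom a) x0 b z (dom_convex a)).
Qed.

(** Together with [is_RInt_gen_primitive], the dictionary between integrals and
    primitives. *)
Lemma primitive_is_RInt a Phi f x y :
  is_primitive a Phi f -> (forall t, dom a t -> continuous f t) -> dom a x -> dom a y ->
  is_RInt (V := C_R_NormedModule) f x y (Phi y - Phi x)%C.
Proof.
  intros HP Hf Hx Hy.
  apply (is_RInt_derive (V := C_R_CompleteNormedModule) Phi f x y).
  - intros t Ht. apply HP. now apply (convex_between (dom a) x y t (dom_convex a)).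
  - intros t Ht. apply Hf. now apply (convex_between (dom a) x y t (dom_convex a)).
Qed.

Lemma primitive_unique a Phi Psi f x y :
  is_primitive a Phi f -> is_primitive a Psi f -> dom a x -> dom a y ->
  (Phi y - Phi x = Psi y - Psi x)%C.
Proof.
  intros H1 H2 Hx Hy.
  assert (K : Cmod ((Phi y - Psi y) - (Phi x - Psi x)) <= Rabs (0 - 0)).
  { apply (mean_value_C_abs (fun t => Phi t - Psi t)%C (fun t => f t - f t)%C (fun _ => 0) (fun _ => 0)).
    - intros t Ht. assert (dom a t) by now apply (convex_between (dom a) x y t (dom_convex a)).
      apply Cderive_minus; [now apply H1|now apply H2].
    - intros t Ht. apply (is_derive_const (K := R_AbsRing) (V := R_NormedModule)).
    - intros t Ht. replace (f t - f t)%C with (RtoC 0) by ring. rewrite Cmod_0. lra. }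
  rewrite Rminus_0_r, Rabs_R0 in K.
  assert (E : ((Phi y - Psi y) - (Phi x - Psi x) = 0)%C).
  { apply Cmod_eq_0. generalize (Cmod_ge_0 ((Phi y - Psi y) - (Phi x - Psi x))%C). lra. }
  replace (Phi y - Phi x)%C with ((Phi y - Psi y - (Phi x - Psi x)) + (Psi y - Psi x))%C by ring.
  rewrite E. ring.
Qed.

Lemma continuous_rcpow p t : 0 < t -> continuous (fun x => rcpow x p) t.
Proof. intros Ht. eapply Cderive_continuous. now apply Cderive_rcpow. Qed.

Lemma continuous_ln_pow n t : 0 < t -> continuous (fun x => RtoC (ln x ^ n)) t.
Proof. intros Ht. eapply Cderive_continuous. now apply Cderive_ln_pow. Qed.

(** * Analyticity of Mellin integrals *)

(** The coefficient of [h^m] in the expansion of [t^(-h)]. *)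
Definition rcpow_coef (m : nat) (t : R) : C := (exp_coef m * (-1) ^ m * RtoC (ln t ^ m))%C.

Lemma psum_rcpow_coef y t h N :
  psum (fun m => y * rcpow_coef m t)%C h N = (y * psum exp_coef (- h * RtoC (ln t)) N)%C.
Proof.
  induction N as [|N IH]; simpl; [ring|].
  rewrite IH. unfold rcpow_coef.
  replace (- h * RtoC (ln t))%C with ((-1) * RtoC (ln t) * h)%C by ring.
  rewrite !Cpow_mult_l, RtoC_pow. ring.
Qed.

(** Term by term integration.  The weight [exp (2 r |ln t|)] in the domination
    hypothesis absorbs the Taylor remainder of [t^(-h)] for all [|h| < r], so the
    partial sums converge to the integral at the rate [2^(-N)]. *)
Lemma mellin_germ (F : (R -> Prop) -> Prop) {FF : ProperFilter F} (a : Rbar) (I : R -> Prop)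
  (phi : R -> C) (W w : R -> R) (x0 L r : R) (z0 : C) :
  Rbar_lt 0 a -> (forall t, dom a t -> continuous phi t) ->
  convex I -> (forall t, I t -> dom a t) -> F I -> I x0 -> 0 < r ->
  (forall t, I t -> Cmod (phi t) * exp (2 * r * Rabs (ln t)) <= w t) ->
  (forall t, I t -> is_derive W t (w t)) ->
  filterlim W F (locally L) ->
  germ (fun z v => forall Phi, is_primitive a Phi (fun t => phi t * rcpow t (- (z - z0)))%C ->
    Clim F (fun b => Phi b - Phi x0)%C v) z0.
Proof.
  intros Ha Hphi HI HID HFI Hx0 Hr Hw HW HL.
  assert (Hprim : forall m, exists Am, exists Phim,
    is_primitive a Phim (fun t => phi t * rcpow_coef m t)%C /\
    Clim F (fun b => Phim b - Phim x0)%C Am).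
  { intros m.
    assert (Hcont : forall t, dom a t -> continuous (fun t => phi t * rcpow_coef m t)%C t).
    { intros t Ht. apply continuous_Cmult; [now apply Hphi|].
      apply continuous_Cmult; [apply continuous_const|]. apply continuous_ln_pow, Ht. }
    destruct (ex_primitive a _ Ha Hcont) as [Phim HPhim].
    destruct (ln_pow_bound (2 * r) m ltac:(lra)) as [K [HK Hln]].
    set (M := Cmod (exp_coef m * (-1) ^ m) * K).
    assert (HM : 0 <= M) by (apply Rmult_le_pos; [apply Cmod_ge_0|lra]).
    destruct (dominated_limit F I Phim (fun t => phi t * rcpow_coef m t)%C
      (fun t => M * W t) (fun t => M * w t) x0 (M * L)) as [l [Hl _]]; try assumption.
    - intros t Ht. now apply HPhim, HID.
    - intros t Ht. now apply is_derive_scal, HW.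
    - intros t Ht. unfold rcpow_coef. rewrite !Cmod_mult, Cmod_R, <- Cmod_mult.
      apply Rle_trans with (M * (Cmod (phi t) * exp (2 * r * Rabs (ln t)))).
      + unfold M.
        replace (Cmod (exp_coef m * (-1) ^ m) * K * (Cmod (phi t) * exp (2 * r * Rabs (ln t))))
          with (Cmod (phi t) * (Cmod (exp_coef m * (-1) ^ m) * (K * exp (2 * r * Rabs (ln t))))) by ring.
        apply Rmult_le_compat_l; [apply Cmod_ge_0|].
        apply Rmult_le_compat_l; [apply Cmod_ge_0|]. apply Hln.
      + apply Rmult_le_compat_l; [exact HM|now apply Hw].
    - apply (filterlim_comp _ _ _ W (fun y => M * y) F (locally L)); [exact HL|].
      exact (filterlim_scal_r (K := R_AbsRing) (V := R_NormedModule) M L).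
    - exists (l - Phim x0)%C, Phim. split; [exact HPhim|].
      apply (Clim_minus F); [exact Hl|apply (Clim_const F)]. }
  apply functional_choice in Hprim. destruct Hprim as [A HA].
  apply functional_choice in HA. destruct HA as [Phis HPhis].
  exists A, r. split; [exact Hr|]. intros h Hh.
  replace (z0 + h - z0)%C with h by ring.
  assert (Hcont : forall t, dom a t -> continuous (fun t => phi t * rcpow t (- h))%C t).
  { intros t Ht. apply continuous_Cmult; [now apply Hphi|]. apply continuous_rcpow, Ht. }
  destruct (ex_primitive a _ Ha Hcont) as [Phi0 HPhi0].
  assert (Hdom : forall N, exists l,
     Clim F (fun t => Phi0 t - psum (fun m => Phis m t) h N)%C l /\
     Cmod (l - (Phi0 x0 - psum (fun m => Phis m x0) h N)) <= Rabs (L - W x0) * (/ 2) ^ N).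
  { intros N.
    assert (Hp2 : 0 < (/ 2) ^ N) by (apply pow_lt; lra).
    assert (Hd : forall t, I t -> Cderive (fun t => psum (fun m => Phis m t) h N) t
        (psum (fun m => phi t * rcpow_coef m t)%C h N)).
    { intros t Ht. clear Hp2. induction N as [|N IH]; simpl; [apply Cderive_const|].
      apply Cderive_plus; [exact IH|].
      replace (phi t * rcpow_coef N t * h ^ N)%C with (h ^ N * (phi t * rcpow_coef N t))%C by ring.
      apply (Cderive_ext (fun t => h ^ N * Phis N t)%C); [intros; ring|].
      apply Cderive_scal. apply HPhis. now apply HID. }
    destruct (dominated_limit F I (fun t => Phi0 t - psum (fun m => Phis m t) h N)%C
      (fun t => phi t * rcpow t (- h) - psum (fun m => phi t * rcpow_coef m t)%C h N)%C
      (fun t => (/ 2) ^ N * W t) (fun t => (/ 2) ^ N * w t) x0 ((/ 2) ^ N * L)) as [l [Hl Hb]]; try assumption.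
    - intros t Ht. apply Cderive_minus; [now apply HPhi0, HID|now apply Hd].
    - intros t Ht. now apply is_derive_scal, HW.
    - intros t Ht. rewrite psum_rcpow_coef.
      unfold rcpow.
      replace (phi t * Cexp (- h * ln t) - phi t * psum exp_coef (- h * ln t) N)%C
        with (phi t * (Cexp (- h * ln t) - psum exp_coef (- h * ln t) N))%C by ring.
      rewrite Cmod_mult.
      apply Rle_trans with ((/ 2) ^ N * (Cmod (phi t) * exp (2 * r * Rabs (ln t)))).
      + replace ((/ 2) ^ N * (Cmod (phi t) * exp (2 * r * Rabs (ln t))))
          with (Cmod (phi t) * ((/ 2) ^ N * exp (2 * r * Rabs (ln t)))) by ring.
        apply Rmult_le_compat_l; [apply Cmod_ge_0|].
        eapply Rle_trans; [apply Cexp_taylor|]. apply Rmult_le_compat_l; [lra|].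
        apply exp_le. rewrite Cmod_mult, Cmod_opp, Cmod_R.
        generalize (Rabs_pos (ln t)) (Cmod_ge_0 h). nra.
      + apply Rmult_le_compat_l; [lra|now apply Hw].
    - apply (filterlim_comp _ _ _ W (fun y => (/ 2) ^ N * y) F (locally L)); [exact HL|].
      exact (filterlim_scal_r (K := R_AbsRing) (V := R_NormedModule) ((/ 2) ^ N) L).
    - exists l. split; [exact Hl|].
      replace (Rabs (L - W x0) * (/ 2) ^ N) with (Rabs ((/ 2) ^ N * L - (/ 2) ^ N * W x0)); [exact Hb|].
      rewrite <- Rmult_minus_distr_l, Rabs_mult, (Rabs_pos_eq ((/ 2) ^ N)) by lra. ring. }
  destruct (Hdom 0%nat) as [l0 [Hl0 _]].
  assert (Hv : Clim F (fun t => Phi0 t - Phi0 x0)%C (l0 - Phi0 x0)%C).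
  { apply (Clim_ext F (fun t => (Phi0 t - psum (fun m => Phis m t) h 0) - Phi0 x0)%C).
    - apply filter_forall. intros t. simpl. ring.
    - apply (Clim_minus F); [exact Hl0|apply (Clim_const F)]. }
  assert (HpA : forall N, Clim F (fun t => psum (fun m => Phis m t) h N - psum (fun m => Phis m x0) h N)%C (psum A h N)).
  { induction N as [|N IH]; simpl.
    - apply (Clim_ext F (fun _ => RtoC 0)); [apply filter_forall; intros; ring|apply (Clim_const F)].
    - apply (Clim_ext F (fun t => (psum (fun m => Phis m t) h N - psum (fun m => Phis m x0) h N) + h ^ N * (Phis N t - Phis N x0))%C).
      + apply filter_forall. intros t. ring.
      + apply (Clim_plus F); [exact IH|].
        replace (A N * h ^ N)%C with (h ^ N * A N)%C by ring.
        apply (Clim_scal F). apply HPhis. }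
  exists (l0 - Phi0 x0)%C. split.
  - apply (Cpseries_of_bound A h _ (Rabs (L - W x0))). intros N.
    destruct (Hdom N) as [l [Hl Hb]].
    replace (l0 - Phi0 x0 - psum A h N)%C with (l - (Phi0 x0 - psum (fun m => Phis m x0) h N))%C; [exact Hb|].
    apply (Clim_unique F (fun t => (Phi0 t - psum (fun m => Phis m t) h N) - (Phi0 x0 - psum (fun m => Phis m x0) h N))%C).
    + apply (Clim_minus F); [exact Hl|apply (Clim_const F)].
    + apply (Clim_ext F (fun t => (Phi0 t - Phi0 x0) - (psum (fun m => Phis m t) h N - psum (fun m => Phis m x0) h N))%C).
      * apply filter_forall. intros t. ring.
      * apply (Clim_minus F); [exact Hv|apply HpA].
  - intros Phi HPhi.
    apply (Clim_ext F (fun b => Phi0 b - Phi0 x0)%C); [|exact Hv].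
    revert HFI. apply filter_imp. intros b Hb.
    apply (primitive_unique a Phi0 Phi (fun t => phi t * rcpow t (- h))%C); auto.
Qed.

(** * Primitives of powers times powers of the logarithm *)

(** The primitive of [t^(p-1) * ln^n t] produced by repeated integration by
    parts; it is the one that tends to 0 at 0 when [0 < Re p]. *)
Fixpoint pow_ln_prim (n : nat) (p : C) (t : R) : C :=
  match n with
  | O => (rcpow t p / p)%C
  | S m => ((RtoC (ln t ^ S m) * rcpow t p - RtoC (INR (S m)) * pow_ln_prim m p t) / p)%C
  end.

Lemma Cderive_pow_ln_prim n (p : C) t : p <> 0 -> 0 < t ->
  Cderive (pow_ln_prim n p) t (RtoC (ln t ^ n) * rcpow t (p - 1))%C.
Proof.
  intros Hp Ht. induction n as [|n IH].
  - apply (Cderive_ext (fun x => / p * rcpow x p)%C); [intros x; simpl; field; exact Hp|].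
    replace (RtoC (ln t ^ 0) * rcpow t (p - 1))%C with (/ p * (p * rcpow t (p - 1)))%C
      by (simpl; field; exact Hp).
    now apply Cderive_scal, Cderive_rcpow.
  - apply (Cderive_ext (fun x => / p * (RtoC (ln x ^ S n) * rcpow x p - RtoC (INR (S n)) * pow_ln_prim n p x))%C).
    + intros x. simpl. field; exact Hp.
    + replace (RtoC (ln t ^ S n) * rcpow t (p - 1))%C with
        (/ p * ((RtoC (INR (S n) * ln t ^ pred (S n)) * rcpow t (- (1)) * rcpow t p
           + RtoC (ln t ^ S n) * (p * rcpow t (p - 1))) - RtoC (INR (S n)) * (RtoC (ln t ^ n) * rcpow t (p - 1))))%C.
      * apply Cderive_scal, Cderive_minus; [|now apply Cderive_scal].
        apply (Cderive_mult (fun x => RtoC (ln x ^ S n)) (fun x => rcpow x p));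
          [now apply Cderive_ln_pow|now apply Cderive_rcpow].
      * simpl pred. replace (p - 1)%C with (- (1) + p)%C by ring. rewrite rcpow_plus, RtoC_mult.
        field. exact Hp.
Qed.

Lemma germ_rcpow x0 q z0 : germ (fun z v => v = rcpow x0 (q - z)) z0.
Proof.
  exists (fun m => rcpow x0 (q - z0) * rcpow_coef m x0)%C, 1. split; [lra|].
  intros h Hh. exists (rcpow x0 (q - (z0 + h))). split; [|reflexivity].
  set (y := rcpow x0 (q - z0)).
  apply (Cpseries_of_bound _ h _ (Cmod y * exp (2 * Cmod (- h * RtoC (ln x0))))). intros N.
  rewrite psum_rcpow_coef.
  replace (q - (z0 + h))%C with ((q - z0) + - h)%C by ring. rewrite rcpow_plus. fold y.
  unfold rcpow at 1.
  replace (y * Cexp (- h * ln x0) - y * psum exp_coef (- h * ln x0) N)%C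
    with (y * (Cexp (- h * ln x0) - psum exp_coef (- h * ln x0) N))%C by ring.
  rewrite Cmod_mult.
  replace (Cmod y * exp (2 * Cmod (- h * ln x0)) * (/ 2) ^ N)
    with (Cmod y * ((/ 2) ^ N * exp (2 * Cmod (- h * ln x0)))) by ring.
  apply Rmult_le_compat_l; [apply Cmod_ge_0|]. apply Cexp_taylor.
Qed.

(** At the base point 1 only [(-1)^n * n! / p^(n+1)] survives, so this is the
    part that carries the pole at [z = q]. *)
Lemma germ_pow_ln_prim_1 n (q z0 : C) : z0 <> q -> germ (fun z v => v = pow_ln_prim n (q - z) 1) z0.
Proof.
  intros Hq.
  assert (Hq0 : (z0 - q)%C <> 0) by now apply Cminus_eq_contra.
  assert (Hd : 0 < Cmod (z0 - q)) by now apply Cmod_gt_0.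
  assert (Hnear : forall h, Cmod h < Cmod (z0 - q) -> (z0 + h - q)%C <> 0 /\ (q - (z0 + h))%C <> 0).
  { intros h Hh.
    assert (K : (z0 + h - q)%C <> 0).
    { intros E. assert (E' : (z0 - q = - h)%C).
      { replace (z0 - q)%C with ((z0 + h - q) - h)%C by ring. rewrite E. ring. }
      rewrite E', Cmod_opp in Hh. lra. }
    split; [exact K|]. intros E. apply K. replace (z0 + h - q)%C with (- (q - (z0 + h)))%C by ring.
    rewrite E. ring. }
  induction n as [|n IH].
  - generalize (germ_affine_div q _ z0 Hq (germ_const (- (1)) z0)).
    apply (germ_imp _ _ z0 _ Hd). intros h v Hh [v1 [-> ->]].
    simpl. rewrite rcpow_base_1. destruct (Hnear h Hh). field. split; assumption.
  - generalize (germ_scal (RtoC (INR (S n))) _ _ (germ_affine_div q _ z0 Hq IH)).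
    apply (germ_imp _ _ z0 _ Hd). intros h v Hh [v1 [[v2 [-> ->]] ->]].
    change (pow_ln_prim (S n) (q - (z0 + h)) 1) with
      ((RtoC (ln 1 ^ S n) * rcpow 1 (q - (z0 + h)) - RtoC (INR (S n)) * pow_ln_prim n (q - (z0 + h)) 1) / (q - (z0 + h)))%C.
    rewrite ln_1, pow_i by lia. destruct (Hnear h Hh). field. split; assumption.
Qed.

Lemma ln_le a b : 0 < a -> a <= b -> ln a <= ln b.
Proof. intros Ha [H|H]; [apply Rlt_le, ln_increasing; lra|rewrite H; lra]. Qed.

(** From the base point 1 to [x0] the primitive varies by a proper integral, to
    which [mellin_germ] applies with the one-point filter at [x0]. *)
Lemma germ_pow_ln_prim n (q z0 : C) x0 : 0 < x0 -> z0 <> q -> germ (fun z v => v = pow_ln_prim n (q - z) x0) z0.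
Proof.
  intros Hx0 Hq.
  set (I := fun t => Rmin 1 x0 <= t <= Rmax 1 x0).
  assert (Hpos : forall t, I t -> 0 < t).
  { intros t [Ht _]. eapply Rlt_le_trans; [|exact Ht]. apply Rmin_glb_lt; lra. }
  set (phi := fun t => (RtoC (ln t ^ n) * rcpow t (q - z0 - 1))%C).
  assert (Hcont : forall t, 0 < t -> continuous phi t).
  { intros t Ht. apply continuous_Cmult; [now apply continuous_ln_pow|now apply continuous_rcpow]. }
  destruct (bounded_continuity (K := R_AbsRing) (V := C_R_NormedModule) phi (Rmin 1 x0) (Rmax 1 x0)) as [M HM].
  { intros t Ht. apply Hcont. now apply Hpos. }
  set (w := M * exp (2 * 1 * Rabs (ln x0))).
  assert (G := mellin_germ (at_point x0) p_infty I phi (fun t => w * t) (fun _ => w) 1 (w * x0) 1 z0).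
  assert (G' : germ (fun z v => forall Phi : R -> C,
    is_primitive p_infty Phi (fun t => (phi t * rcpow t (- (z - z0)))%C) ->
    Clim (at_point x0) (fun b => (Phi b - Phi 1)%C) v) z0).
  { apply G.
    - exact Logic.I.
    - intros t [Ht _]. now apply Hcont.
    - intros x y t Hx Hy Ht. unfold I in *. lra.
    - intros t Ht. split; [now apply Hpos|exact Logic.I].
    - unfold at_point, I. split; [apply Rmin_r|apply Rmax_r].
    - unfold I. split; [apply Rmin_l|apply Rmax_l].
    - lra.
    - intros t Ht. unfold w. apply Rmult_le_compat; [apply Cmod_ge_0|apply Rlt_le, exp_pos| |].
      + rewrite <- norm_R_Cmod. apply Rlt_le, HM, Ht.
      + apply exp_le. apply Rmult_le_compat_l; [lra|].
        assert (Htp := Hpos t Ht). destruct Ht as [Ht1 Ht2].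
        destruct (Rle_or_lt 1 x0) as [H|H].
        * rewrite Rmin_left, Rmax_right in * by lra.
          assert (H1 := ln_le 1 t Rlt_0_1 Ht1). assert (H2 := ln_le t x0 Htp Ht2). rewrite ln_1 in H1.
          rewrite !Rabs_pos_eq by lra. lra.
        * rewrite Rmin_right, Rmax_left in * by lra.
          assert (H1 := ln_le t 1 Htp Ht2). assert (H2 := ln_le x0 t Hx0 Ht1). rewrite ln_1 in H1.
          rewrite !Rabs_left1 by lra. lra.
    - intros t Ht. evar_last; [apply is_derive_scal, (is_derive_id (K := R_AbsRing))|].
      change (w * 1 = w). ring.
    - intros P HP. unfold filtermap, at_point. now apply locally_singleton in HP. }
  generalize (germ_plus _ _ _ G' (germ_pow_ln_prim_1 n q z0 Hq)).
  apply (germ_imp _ _ z0 (Cmod (z0 - q))); [now apply Cmod_gt_0, Cminus_eq_contra|].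
  intros h v Hh [v1 [v2 [H1 [-> ->]]]].
  assert (Hp : (q - (z0 + h))%C <> 0).
  { intros E. assert (E' : (z0 - q = - h)%C).
    { replace (z0 - q)%C with (- (q - (z0 + h)) - h)%C by ring. rewrite E. ring. }
    rewrite E', Cmod_opp in Hh. lra. }
  assert (K := H1 (pow_ln_prim n (q - (z0 + h)))).
  assert (K1 : v1 = (pow_ln_prim n (q - (z0 + h)) x0 - pow_ln_prim n (q - (z0 + h)) 1)%C).
  { apply (Clim_unique (at_point x0) (fun b => (pow_ln_prim n (q - (z0 + h)) b - pow_ln_prim n (q - (z0 + h)) 1)%C)).
    - apply K. intros t [Ht _].
      replace (phi t * rcpow t (- (z0 + h - z0)))%C with (RtoC (ln t ^ n) * rcpow t (q - (z0 + h) - 1))%C.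
      + now apply Cderive_pow_ln_prim.
      + unfold phi. rewrite <- Cmult_assoc, <- rcpow_plus. do 2 f_equal. ring.
    - intros P HP. unfold filtermap, at_point. now apply locally_singleton in HP. }
  rewrite K1. ring.
Qed.

(** * Functions of the class K and the endpoint 0 *)

Lemma analytic_continuous f z0 : analytic_at f z0 -> forall eps, 0 < eps -> exists r, 0 < r /\
  forall z, Cmod (z - z0) < r -> Cmod (f z - f z0) < eps.
Proof.
  intros [c Hc] eps He. apply locally_Cmod in Hc. destruct Hc as [r [Hr H]].
  assert (Hw := H (z0 + RtoC (r / 2))%C).
  replace (z0 + RtoC (r / 2) - z0)%C with (RtoC (r / 2)) in Hw by ring.
  rewrite Cmod_R, Rabs_pos_eq in Hw by lra. specialize (Hw ltac:(lra)).
  destruct (Cpseries_terms_bounded _ _ _ Hw) as [B [HB HBm]].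
  rewrite Cmod_R, Rabs_pos_eq in HBm by lra.
  set (R0 := r / 2) in *. assert (HR : 0 < R0) by (unfold R0; lra).
  set (e := Rmin (R0 / 2) (eps * R0 / (4 * B))).
  assert (He0 : 0 < e).
  { apply Rmin_glb_lt; [lra|]. apply Rdiv_lt_0_compat; [apply Rmult_lt_0_compat|]; lra. }
  assert (He1 := Rmin_l (R0 / 2) (eps * R0 / (4 * B)) : e <= _).
  assert (He2 := Rmin_r (R0 / 2) (eps * R0 / (4 * B)) : e <= _).
  assert (Hbd : forall z, Cmod (z - z0) < e -> Cmod (f z - c 0%nat) < eps / 2).
  { intros z Hz. assert (K := Cpseries_remainder c (z - z0) (f z) R0 B 1 HR HBm ltac:(lra) (H z ltac:(unfold R0 in *; lra))).
    replace (f z - psum c (z - z0) 1)%C with (f z - c 0%nat)%C in K by (simpl; ring).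
    eapply Rle_lt_trans; [exact K|]. rewrite pow_1.
    apply (Rmult_lt_reg_r (R0 / (2 * B))); [apply Rdiv_lt_0_compat; lra|].
    replace (2 * B * (Cmod (z - z0) / R0) * (R0 / (2 * B))) with (Cmod (z - z0)) by (field; lra).
    replace (eps / 2 * (R0 / (2 * B))) with (eps * R0 / (4 * B)) by (field; lra). lra. }
  exists e. split; [exact He0|]. intros z Hz.
  replace (f z - f z0)%C with ((f z - c 0%nat) + - (f z0 - c 0%nat))%C by ring.
  eapply Rle_lt_trans; [apply Cmod_triangle|]. rewrite Cmod_opp.
  generalize (Hbd z Hz). assert (K := Hbd z0).
  replace (z0 - z0)%C with (RtoC 0) in K by ring. rewrite Cmod_0 in K. specialize (K He0). lra.
Qed.

Lemma class_K_continuous a d k t : class_K a d k -> dom a t -> continuous k t.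
Proof.
  intros [_ [[kc Hkc] _]] Ht.
  assert (E : forall s, dom a s -> k s = kc (RtoC s)) by (intros s Hs; apply Hkc; destruct Hs; [lra|assumption]).
  destruct (Hkc t) as [_ Han]; [destruct Ht; lra|apply Ht|].
  apply (filterlim_Cmod (locally t)). intros eps He.
  destruct (analytic_continuous kc t Han eps He) as [r [Hr H]].
  assert (Hb : locally t (fun s => Rabs (s - t) < r)) by (exists (mkposreal r Hr); intros s Hs; exact Hs).
  generalize (filter_and _ _ Hb (dom_locally a t Ht)). apply filter_imp. intros s [Hs1 Hs2].
  rewrite (E s Hs2), (E t Ht). apply H. rewrite <- RtoC_minus, Cmod_R. exact Hs1.
Qed.

Lemma class_K_taylor a d k : Rbar_lt 0 a -> class_K a d k ->
  exists (c : nat -> C) (rho : R), dom a rho /\ rho <= 1 /\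
    forall N, exists M, 0 <= M /\ forall t, 0 < t <= rho -> Cmod (k t - psum c t N) <= M * t ^ N.
Proof.
  intros Ha [_ [[kc Hkc] _]].
  destruct (Hkc 0 (Rle_refl 0) Ha) as [_ [c Hc]].
  apply locally_Cmod in Hc. destruct Hc as [r [Hr H]].
  assert (H' : forall t, 0 < t < r -> Cpseries c t (kc t)).
  { intros t Ht. specialize (H t). replace (t - 0)%C with (RtoC t) in H by ring. apply H.
    rewrite Cmod_R, Rabs_pos_eq; lra. }
  destruct (Cpseries_terms_bounded _ _ _ (H' (r / 2) ltac:(lra))) as [B [HB HBm]].
  rewrite Cmod_R, Rabs_pos_eq in HBm by lra.
  set (R0 := r / 2) in *. assert (HR : 0 < R0) by (unfold R0; lra).
  destruct (dom_inhabited a Ha) as [x0 Hx0].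
  set (rho := Rmin x0 (Rmin 1 (R0 / 2))).
  assert (Hr0 : 0 < rho) by (destruct Hx0; repeat apply Rmin_glb_lt; lra).
  assert (Hr1 : rho <= x0) by apply Rmin_l.
  assert (Hr2 : rho <= Rmin 1 (R0 / 2)) by apply Rmin_r.
  assert (Hr3 := Rmin_l 1 (R0 / 2)). assert (Hr4 := Rmin_r 1 (R0 / 2)).
  assert (Hda : forall t, 0 < t <= rho -> dom a t).
  { intros t Ht. split; [lra|]. destruct Hx0 as [_ Hx0].
    apply (Rbar_le_lt_trans t x0); [simpl; lra|exact Hx0]. }
  exists c, rho. split; [apply Hda; lra|]. split; [lra|].
  intros N. exists (2 * B * (/ R0) ^ N). split.
  - apply Rmult_le_pos; [lra|]. apply pow_le, Rlt_le, Rinv_0_lt_compat, HR.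
  - intros t Ht. destruct (Hkc t) as [-> _]; [lra|apply Hda, Ht|].
    assert (Htm : Cmod t = t) by (rewrite Cmod_R, Rabs_pos_eq; lra).
    eapply Rle_trans; [apply (Cpseries_remainder c t (kc t) R0 B N HR HBm)|].
    + rewrite Htm; lra.
    + apply H'. unfold R0 in *; lra.
    + rewrite Htm. unfold Rdiv. rewrite Rpow_mult_distr. right. ring.
Qed.

Lemma continuous_psum c N t : continuous (fun x => psum c (RtoC x) N) t.
Proof.
  assert (Hid : continuous RtoC t).
  { eapply Cderive_continuous. apply (Cderive_RtoC (fun x => x)). apply (is_derive_id (K := R_AbsRing)). }
  assert (Hpow : forall m, continuous (fun x => RtoC x ^ m)%C t).
  { induction m as [|m IH]; [apply continuous_const|].
    apply (continuous_ext (fun x => RtoC x * RtoC x ^ m)%C); [intros; now rewrite Cpow_S|].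
    now apply continuous_Cmult. }
  induction N as [|N IH]; simpl; [apply continuous_const|].
  apply continuous_Cplus; [exact IH|]. apply continuous_Cmult; [apply continuous_const|apply Hpow].
Qed.

Lemma continuous_integrand a d k n z t : class_K a d k -> dom a t -> continuous (integrand k n z) t.
Proof.
  intros Hk Ht. destruct (Ht) as [Ht0 _].
  apply continuous_Cmult; [apply continuous_Cmult|].
  - now apply (class_K_continuous a d).
  - now apply continuous_ln_pow.
  - now apply continuous_rcpow.
Qed.

(** The Taylor remainder of order [N] beats [t^(-Re z)] with two powers of [t] to
    spare: one pays for [ln^n t], the other for the weight of [mellin_germ] with
    [r = 1/2], so the weighted integrand is bounded near 0. *)
Lemma head_germ a d k n c rho M N z0 :
  Rbar_lt 0 a -> class_K a d k -> dom a rho -> rho <= 1 -> 0 <= M ->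
  (forall t, 0 < t <= rho -> Cmod (k t - psum c t N) <= M * t ^ N) ->
  Re z0 + 2 <= INR N ->
  germ (fun z v => forall Phi,
    is_primitive a Phi (fun t => (k t - psum c t N) * RtoC (ln t ^ n) * rcpow t (- z))%C ->
    Clim (at_right 0) (fun b => Phi b - Phi rho)%C v) z0.
Proof.
  intros Ha Hk Hrho Hrho1 HM Hrem HN.
  destruct (ln_pow_bound 1 n Rlt_0_1) as [K [HK Hln]].
  set (phi := fun t => ((k t - psum c t N) * RtoC (ln t ^ n) * rcpow t (- z0))%C).
  assert (HID : forall t, 0 < t <= rho -> dom a t).
  { intros t Ht. split; [lra|]. destruct Hrho as [_ Hrho].
    apply (Rbar_le_lt_trans t rho); [simpl; lra|exact Hrho]. }
  assert (G := mellin_germ (at_right 0) a (fun t => 0 < t <= rho) phi (fun t => M * K * t) (fun _ => M * K)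
    rho (M * K * 0) (/ 2) z0).
  apply (germ_imp (fun z v => forall Phi, is_primitive a Phi (fun t => phi t * rcpow t (- (z - z0)))%C ->
    Clim (at_right 0) (fun b => Phi b - Phi rho)%C v) _ z0 1 Rlt_0_1).
  { intros h v _ H Phi HPhi. apply H. intros t Ht.
    replace (phi t * rcpow t (- (z0 + h - z0)))%C
      with ((k t - psum c t N) * RtoC (ln t ^ n) * rcpow t (- (z0 + h)))%C; [now apply HPhi|].
    unfold phi. replace (- (z0 + h))%C with (- z0 + - (z0 + h - z0))%C by ring.
    rewrite rcpow_plus. ring. }
  apply G; try assumption.
  - intros t Ht. destruct (Ht) as [Ht0 _].
    apply continuous_Cmult; [apply continuous_Cmult; [apply continuous_Cminus|]|].
    + now apply (class_K_continuous a d).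
    + apply continuous_psum.
    + now apply continuous_ln_pow.
    + now apply continuous_rcpow.
  - intros x y t Hx Hy Ht. lra.
  - destruct Hrho as [Hrho _]. exists (mkposreal rho Hrho). intros t Ht Ht0.
    change (Rabs (t - 0) < rho) in Ht. rewrite Rminus_0_r, Rabs_pos_eq in Ht; lra.
  - destruct Hrho; lra.
  - lra.
  - intros t Ht. unfold phi. rewrite !Cmod_mult, Cmod_R, Cmod_rcpow.
    assert (Hl : ln t <= 0) by (rewrite <- ln_1; apply ln_le; lra).
    assert (Habs : Rabs (ln t) = - ln t) by (apply Rabs_left1; lra).
    assert (Hl' := Hln t). rewrite Habs in *.
    assert (Ht' := Hrem t Ht).
    assert (Htn : t ^ N = exp (INR N * ln t)).
    { rewrite <- Rpower_pow by lra. reflexivity. }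
    apply Rle_trans with ((M * t ^ N) * (K * exp (1 * - ln t)) * exp (Re (- z0) * ln t) * exp (2 * / 2 * - ln t)).
    + repeat (apply Rmult_le_compat_r; [apply Rlt_le, exp_pos|]).
      apply Rmult_le_compat; [apply Cmod_ge_0|apply Rabs_pos|exact Ht'|exact Hl'].
    + rewrite Htn.
      replace (M * exp (INR N * ln t) * (K * exp (1 * - ln t)) * exp (Re (- z0) * ln t) * exp (2 * / 2 * - ln t))
        with (M * K * exp (INR N * ln t + 1 * - ln t + Re (- z0) * ln t + 2 * / 2 * - ln t))
        by (rewrite !exp_plus; ring).
      assert (E : exp (INR N * ln t + 1 * - ln t + Re (- z0) * ln t + 2 * / 2 * - ln t) <= 1).
      { apply Rle_trans with (exp 0); [apply exp_le|rewrite exp_0; lra].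
        assert (0 <= (INR N - Re z0 - 2) * - ln t) by (apply Rmult_le_pos; lra).
        replace (Re (- z0)) with (- Re z0) by reflexivity. lra. }
      assert (0 <= M * K) by (apply Rmult_le_pos; lra). nra.
  - intros t Ht. evar_last; [apply is_derive_scal, (is_derive_id (K := R_AbsRing))|].
    change (M * K * 1 = M * K). ring.
  - apply (filterlim_filter_le_1 (F := locally 0) (G := at_right 0)); [apply filter_le_within|].
    apply (ex_derive_continuous (K := R_AbsRing) (V := R_NormedModule) (fun t => M * K * t) 0).
    auto_derive. easy.
Qed.

(** * The endpoint a *)

Lemma below_iff (a : Rbar) (P : R -> Prop) x0 : dom a x0 ->
  below a P <-> exists T, x0 <= T /\ dom a T /\ forall t, T <= t -> dom a t -> P t.
Proof.
  intros [Hx0 Hx0a]. destruct a as [a| |]; simpl in Hx0a; [| |contradiction].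
  - split.
    + intros [e He]. exists (Rmax x0 (a - e / 2)).
      assert (He0 := cond_pos e).
      split; [apply Rmax_l|]. split.
      * split; simpl; [eapply Rlt_le_trans; [exact Hx0|apply Rmax_l]|]. apply Rmax_lub_lt; lra.
      * intros t Ht [Ht0 Hta]. simpl in Hta. apply He; [|exact Hta].
        change (Rabs (t - a) < e). rewrite Rabs_left1 by lra.
        generalize (Rmax_r x0 (a - e / 2)). lra.
    + intros [T [HT [[HT0 HTa] H]]]. simpl in HTa.
      assert (Hd : 0 < a - T) by lra.
      exists (mkposreal _ Hd). intros t Ht Hta. change (Rabs (t - a) < a - T) in Ht.
      simpl in Hta. rewrite Rabs_left1 in Ht by lra.
      apply H; [lra|]. split; simpl; lra.
  - split.
    + intros [M HM]. exists (Rmax x0 (M + 1)).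
      split; [apply Rmax_l|]. split.
      * split; simpl; [eapply Rlt_le_trans; [exact Hx0|apply Rmax_l]|easy].
      * intros t Ht Hd. apply HM; [|easy]. generalize (Rmax_r x0 (M + 1)). lra.
    + intros [T [HT [[HT0 _] H]]]. exists T. intros t Ht _.
      apply H; [lra|]. split; simpl; [lra|easy].
Qed.

Lemma below_proper (a : Rbar) : Rbar_lt 0 a -> ProperFilter (below a).
Proof.
  intros Ha. destruct (dom_inhabited a Ha) as [x0 Hx0]. constructor.
  - intros P HP. apply (below_iff a P x0 Hx0) in HP. destruct HP as [T [_ [HT H]]].
    exists T. apply H; [lra|exact HT].
  - unfold below. destruct a; typeclasses eauto.
Qed.

Lemma below_dom a x0 : dom a x0 -> below a (fun t => x0 <= t /\ dom a t).
Proof.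
  intros H. apply (below_iff a _ x0 H). exists x0. split; [lra|]. split; [exact H|]. intros t Ht Hd. now split.
Qed.

Lemma at_right_dom a : Rbar_lt 0 a -> at_right 0 (dom a).
Proof.
  intros Ha. destruct (dom_inhabited a Ha) as [x0 [Hx0 Hx0a]].
  exists (mkposreal x0 Hx0). intros t Ht Ht0. change (Rabs (t - 0) < x0) in Ht.
  rewrite Rminus_0_r, Rabs_pos_eq in Ht by lra. split; [exact Ht0|].
  apply (Rbar_lt_trans t x0); [exact Ht|exact Hx0a].
Qed.

Lemma exp_ln_limit_below a delta : Rbar_lt 0 a -> 0 < delta ->
  exists L, filterlim (fun t => exp (- delta * ln t)) (below a) (locally L).
Proof.
  intros Ha Hd. destruct a as [a| |]; simpl in Ha; [| |contradiction].
  - exists (exp (- delta * ln a)).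
    apply (filterlim_filter_le_1 (F := locally a) (G := below a)).
    + unfold below. apply filter_le_within.
    + apply (ex_derive_continuous (K := R_AbsRing) (V := R_NormedModule) (fun t => exp (- delta * ln t)) a).
      auto_derive. exact Ha.
  - exists 0.
    apply (filterlim_filter_le_1 (F := Rbar_locally p_infty) (G := below p_infty)).
    + unfold below. apply filter_le_within.
    + apply (filterlim_comp _ _ _ (fun t => - delta * ln t) exp _ (Rbar_locally m_infty)).
      * apply (filterlim_comp _ _ _ ln (fun y => - delta * y) _ (Rbar_locally p_infty)); [apply is_lim_ln_p|].
        replace m_infty with (Rbar_mult (- delta) p_infty).
        -- apply (filterlim_Rbar_mult_l (- delta) p_infty).
        -- simpl. destruct (Rle_dec 0 (- delta)); [exfalso; lra|reflexivity].
      * apply is_lim_exp_m.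
Qed.

Lemma continuous_bounded_segment (f : R -> C) x y :
  (forall t, x <= t <= y -> continuous f t) -> exists B, forall t, x <= t <= y -> Cmod (f t) <= B.
Proof.
  intros H. destruct (bounded_continuity (K := R_AbsRing) (V := C_R_NormedModule) f x y) as [B HB].
  - exact H.
  - exists B. intros t Ht. rewrite <- norm_R_Cmod. now apply Rlt_le, HB.
Qed.

Lemma continuous_limit_bounded a x0 H l : Rbar_lt 0 a -> dom a x0 ->
  (forall t, dom a t -> continuous H t) -> Clim (below a) H l ->
  exists B, 0 <= B /\ forall t, x0 <= t -> dom a t -> Cmod (H t) <= B.
Proof.
  intros Ha Hx0 Hc Hl. assert (FF := below_proper a Ha).
  apply (Clim_bounded (below a)) in Hl. apply (below_iff a _ x0 Hx0) in Hl.
  destruct Hl as [T [HT [HTd Hb]]].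
  destruct (continuous_bounded_segment H x0 T) as [B HB].
  { intros t Ht. apply Hc. now apply (dom_convex a x0 T). }
  exists (Rmax B (Cmod l + 1)). split.
  - eapply Rle_trans; [|apply Rmax_r]. generalize (Cmod_ge_0 l). lra.
  - intros t Ht Htd. destruct (Rle_or_lt T t) as [H1|H1].
    + eapply Rle_trans; [now apply Hb|apply Rmax_r].
    + eapply Rle_trans; [apply HB; lra|apply Rmax_l].
Qed.

Lemma is_RInt_gen_primitive a Fa Fb {FFa : ProperFilter Fa} {FFb : ProperFilter Fb} Phi f v :
  is_primitive a Phi f -> (forall t, dom a t -> continuous f t) -> Fa (dom a) -> Fb (dom a) ->
  is_RInt_gen (V := C_R_NormedModule) f Fa Fb v <->
  Clim (filter_prod Fa Fb) (fun ab => Phi (snd ab) - Phi (fst ab))%C v.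
Proof.
  intros HP Hf Ha Hb.
  assert (Hd : filter_prod Fa Fb (fun ab => dom a (fst ab) /\ dom a (snd ab))).
  { exists (dom a) (dom a); auto. }
  split.
  - intros H. apply (filterlim_Cmod (filter_prod Fa Fb)). intros eps He.
    assert (Hl : locally v (fun z => Cmod (z - v) < eps)) by (apply locally_Cmod; now exists eps).
    assert (H' := H _ Hl). unfold filtermapi in H'.
    generalize (filter_and _ _ H' Hd). apply filter_imp.
    intros [x y] [[w [Hw1 Hw2]] [Hx Hy]]. simpl in *.
    replace (Phi y - Phi x)%C with w; [exact Hw2|].
    assert (K := primitive_is_RInt a Phi f x y HP Hf Hx Hy).
    rewrite <- (is_RInt_unique (V := C_R_CompleteNormedModule) f x y _ K).
    symmetry. now apply (is_RInt_unique (V := C_R_CompleteNormedModule)).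
  - intros H P HP'. specialize (H P HP'). unfold filtermap in H. unfold filtermapi.
    generalize (filter_and _ _ H Hd). apply filter_imp.
    intros [x y] [H1 [Hx Hy]]. simpl in *. exists (Phi y - Phi x)%C. split; [|exact H1].
    now apply (primitive_is_RInt a).
Qed.

Lemma is_RInt_gen_limits a Fa Fb {FFa : ProperFilter Fa} {FFb : ProperFilter Fb} Phi f la lb :
  is_primitive a Phi f -> (forall t, dom a t -> continuous f t) -> Fa (dom a) -> Fb (dom a) ->
  Clim Fa Phi la -> Clim Fb Phi lb ->
  is_RInt_gen (V := C_R_NormedModule) f Fa Fb (lb - la)%C.
Proof.
  intros HP Hf Ha Hb Hla Hlb. apply (is_RInt_gen_primitive a Fa Fb Phi); auto.
  apply (Clim_minus (filter_prod Fa Fb)).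
  - unfold Clim. eapply filterlim_comp; [apply filterlim_snd|exact Hlb].
  - unfold Clim. eapply filterlim_comp; [apply filterlim_fst|exact Hla].
Qed.

(** Convergence of the doubly improper integral gives the Cauchy criterion at the
    second end, by fixing a point close to the first one. *)
Lemma RInt_gen_primitive_limit a Fa Fb {FFa : ProperFilter Fa} {FFb : ProperFilter Fb} Phi f v :
  is_primitive a Phi f -> (forall t, dom a t -> continuous f t) -> Fa (dom a) -> Fb (dom a) ->
  is_RInt_gen (V := C_R_NormedModule) f Fa Fb v -> exists l, Clim Fb Phi l.
Proof.
  intros HP Hf Ha Hb H. apply (is_RInt_gen_primitive a Fa Fb Phi) in H; auto.
  apply (filterlim_locally_cauchy (U := C_R_CompleteNormedModule) (F := Fb) Phi).
  intros eps.
  assert (He : 0 < eps / 2) by (generalize (cond_pos eps); lra).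
  destruct (proj1 (filterlim_Cmod (filter_prod Fa Fb) _ _) H (eps / 2) He) as [P Q HPa HQb HPQ].
  exists Q. split; [exact HQb|]. intros u w Hu Hw.
  destruct (filter_ex P HPa) as [x Hx].
  apply C_NormedModule_mixin_compat1.
  change (Cmod (Phi w - Phi u) < eps).
  assert (H1 := HPQ x u Hx Hu). assert (H2 := HPQ x w Hx Hw). simpl in H1, H2.
  replace (Phi w - Phi u)%C with ((Phi w - Phi x - v) + - (Phi u - Phi x - v))%C by ring.
  eapply Rle_lt_trans; [apply Cmod_triangle|]. rewrite Cmod_opp. lra.
Qed.

(** [H] is the tail, from [t] to [a], of the integral of [k s * s^(-sigma)]; it
    is all that is used of the possibly conditional convergence at [a]. *)
Lemma class_K_tail a d k (sigma : R) : Rbar_lt 0 a -> class_K a d k -> Rbar_lt d sigma -> sigma < 1 ->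
  exists H : R -> C, is_primitive a H (fun t => - (k t * rcpow t (- RtoC sigma)))%C /\ Clim (below a) H 0.
Proof.
  intros Ha Hk Hd H1. assert (FF := below_proper a Ha).
  assert (Hc : forall t, dom a t -> continuous (integrand k 0 sigma) t).
  { intros t Ht. now apply (continuous_integrand a d). }
  destruct (ex_primitive a _ Ha Hc) as [Phi HPhi].
  destruct (Hk) as [_ [_ [_ [_ HM]]]].
  destruct (HM sigma) as [v Hv]; [split; [exact Hd|exact H1]|].
  destruct (RInt_gen_primitive_limit a (at_right 0) (below a) Phi _ v HPhi Hc) as [l Hl].
  - now apply at_right_dom.
  - destruct (dom_inhabited a Ha) as [x0 Hx0]. generalize (below_dom a x0 Hx0). apply filter_imp. tauto.
  - exact Hv.
  - exists (fun t => l - Phi t)%C. split.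
    + intros t Ht.
      replace (- (k t * rcpow t (- sigma)))%C with (0 - integrand k 0 sigma t)%C.
      * apply Cderive_minus; [apply Cderive_const|now apply HPhi].
      * unfold integrand. simpl. ring.
    + replace (RtoC 0) with (l - l)%C by ring. apply (Clim_minus (below a)); [apply (Clim_const (below a))|exact Hl].
Qed.

(** Away from 0 the weight [exp (eta |ln t|)] costs only a power [t^eta], up to a
    constant. *)
Lemma abs_ln_le x0 t : 0 < x0 -> x0 <= t -> Rabs (ln t) <= ln t + 2 * Rabs (ln x0).
Proof.
  intros H0 Ht. assert (K := ln_le x0 t H0 Ht).
  unfold Rabs. destruct (Rcase_abs (ln t)), (Rcase_abs (ln x0)); lra.
Qed.

(** The absolutely convergent integrals left by the integration by parts: with
    [2 delta = Re z0 - sigma], the factor [t^(sigma - z0 - 1)] leaves room for a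
    loss of [t^delta] (powers of the logarithm and weight of [mellin_germ]) and is
    still dominated by [t^(-1-delta)], integrable at infinity. *)
Lemma weighted_tail_germ a x0 H B (sigma : R) m z0 :
  Rbar_lt 0 a -> dom a x0 -> (forall t, dom a t -> continuous H t) ->
  0 <= B -> (forall t, x0 <= t -> dom a t -> Cmod (H t) <= B) -> sigma < Re z0 ->
  germ (fun z v => forall Phi,
    is_primitive a Phi (fun t => H t * RtoC (ln t ^ m) * rcpow t (RtoC sigma - z - 1))%C ->
    Clim (below a) (fun b => Phi b - Phi x0)%C v) z0.
Proof.
  intros Ha Hx0 Hc HB0 HB Hs. assert (FF := below_proper a Ha).
  set (delta := (Re z0 - sigma) / 2). assert (Hdelta : 0 < delta) by (unfold delta; lra).
  set (eta := delta / 2). assert (Heta : 0 < eta) by (unfold eta; lra).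
  destruct (ln_pow_bound eta m Heta) as [K [HK Hln]].
  set (E := exp (2 * Rabs (ln x0) * (eta + eta))).
  set (M := B * K * E).
  assert (HE : 0 < E) by apply exp_pos.
  assert (HM : 0 <= M) by (unfold M; repeat apply Rmult_le_pos; lra).
  destruct (exp_ln_limit_below a delta Ha Hdelta) as [L HL].
  set (phi := fun t => (H t * RtoC (ln t ^ m) * rcpow t (RtoC sigma - z0 - 1))%C).
  apply (germ_imp (fun z v => forall Phi, is_primitive a Phi (fun t => phi t * rcpow t (- (z - z0)))%C ->
    Clim (below a) (fun b => Phi b - Phi x0)%C v) _ z0 1 Rlt_0_1).
  { intros h v _ Hv Phi HPhi. apply Hv. intros t Ht.
    replace (phi t * rcpow t (- (z0 + h - z0)))%C
      with (H t * RtoC (ln t ^ m) * rcpow t (RtoC sigma - (z0 + h) - 1))%C; [now apply HPhi|].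
    unfold phi. replace (RtoC sigma - (z0 + h) - 1)%C with ((RtoC sigma - z0 - 1) + - (z0 + h - z0))%C by ring.
    rewrite rcpow_plus. ring. }
  apply (mellin_germ (below a) a (fun t => x0 <= t /\ dom a t) phi
    (fun t => - (M / delta) * exp (- delta * ln t)) (fun t => M * exp (- (delta + 1) * ln t))
    x0 (- (M / delta) * L) (eta / 2) z0); try assumption.
  - intros t Ht. destruct (Ht) as [Ht0 _].
    apply continuous_Cmult; [apply continuous_Cmult|].
    + now apply Hc.
    + now apply continuous_ln_pow.
    + now apply continuous_rcpow.
  - intros x y t [Hx Hxd] [Hy Hyd] Ht. split; [lra|]. now apply (dom_convex a x y).
  - tauto.
  - now apply below_dom.
  - split; [lra|exact Hx0].
  - lra.
  - intros t [Ht Htd]. unfold phi. rewrite !Cmod_mult, Cmod_R, Cmod_rcpow.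
    assert (HBt := HB t Ht Htd). assert (Hl := Hln t).
    assert (Habs := abs_ln_le x0 t (proj1 Hx0) Ht).
    apply Rle_trans with (B * (K * exp (eta * Rabs (ln t))) * exp (Re (sigma - z0 - 1) * ln t) * exp (2 * (eta / 2) * Rabs (ln t))).
    + repeat (apply Rmult_le_compat_r; [apply Rlt_le, exp_pos|]).
      apply Rmult_le_compat; [apply Cmod_ge_0|apply Rabs_pos|exact HBt|exact Hl].
    + replace (B * (K * exp (eta * Rabs (ln t))) * exp (Re (sigma - z0 - 1) * ln t) * exp (2 * (eta / 2) * Rabs (ln t)))
        with (B * K * exp (eta * Rabs (ln t) + Re (sigma - z0 - 1) * ln t + 2 * (eta / 2) * Rabs (ln t)))
        by (rewrite !exp_plus; ring).
      unfold M, E. rewrite (Rmult_assoc (B * K)), <- exp_plus.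
      apply Rmult_le_compat_l; [apply Rmult_le_pos; lra|]. apply exp_le.
      replace (Re (sigma - z0 - 1)) with (- (2 * delta) - 1).
      * assert (eta * Rabs (ln t) <= eta * (ln t + 2 * Rabs (ln x0))) by (apply Rmult_le_compat_l; lra).
        replace delta with (2 * eta) by (unfold eta; field). lra.
      * unfold delta. destruct z0 as [z1 z2]. unfold Re. simpl. field.
  - intros t [Ht Htd]. destruct (Htd) as [Ht0 _]. auto_derive; [exact Ht0|].
    replace (- (delta + 1) * ln t) with (- delta * ln t + - ln t) by ring.
    rewrite exp_plus, exp_Ropp, exp_ln by exact Ht0. field. lra.
  - apply (filterlim_comp _ _ _ (fun t => exp (- delta * ln t)) (fun y => - (M / delta) * y) (below a) (locally L)); [exact HL|].
    exact (filterlim_scal_r (K := R_AbsRing) (V := R_NormedModule) (- (M / delta)) L).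
Qed.

Lemma between_sigma (d : Rbar) (x : R) : Rbar_lt d x -> Rbar_lt d 1 ->
  exists sigma : R, Rbar_lt d sigma /\ sigma < 1 /\ sigma < x.
Proof.
  intros H1 H2. destruct d as [d| |]; simpl in *; try contradiction.
  - exists ((d + Rmin 1 x) / 2). assert (d < Rmin 1 x) by now apply Rmin_glb_lt.
    generalize (Rmin_l 1 x) (Rmin_r 1 x). lra.
  - exists (Rmin 1 x - 1). generalize (Rmin_l 1 x) (Rmin_r 1 x). split; [exact I|]. lra.
Qed.

(** Integration by parts against the tail [H] of [class_K_tail]: the boundary term
    at [a] vanishes because [H] tends to 0 and [t^(sigma - z) * ln^n t] stays
    bounded. *)
Lemma tail_germ a d k n x0 z0 : Rbar_lt 0 a -> class_K a d k -> dom a x0 -> Rbar_lt d (Re z0) ->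
  germ (fun z v => forall Phi, is_primitive a Phi (integrand k n z) ->
    Clim (below a) (fun b => Phi b - Phi x0)%C v) z0.
Proof.
  intros Ha Hk Hx0 Hd. assert (FF := below_proper a Ha).
  destruct (between_sigma d (Re z0) Hd ltac:(apply Hk)) as [sigma [Hs1 [Hs2 Hs3]]].
  destruct (class_K_tail a d k sigma Ha Hk Hs1 Hs2) as [H [HH Hlim]].
  assert (HHc : forall t, dom a t -> continuous H t).
  { intros t Ht. eapply Cderive_continuous. now apply HH. }
  destruct (continuous_limit_bounded a x0 H 0 Ha Hx0 HHc Hlim) as [B [HB0 HB]].
  set (U := fun m z v => forall Phi,
    is_primitive a Phi (fun t => H t * RtoC (ln t ^ m) * rcpow t (RtoC sigma - z - 1))%C ->
    Clim (below a) (fun b => Phi b - Phi x0)%C v).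
  assert (GU : forall m, germ (U m) z0).
  { intros m. now apply (weighted_tail_germ a x0 H B). }
  assert (G0 := germ_scal (H x0 * RtoC (ln x0 ^ n))%C _ _ (germ_rcpow x0 (RtoC sigma) z0)).
  assert (G1 := germ_scal (- (1)) _ _ (germ_affine_mult (RtoC sigma) _ _ (GU n))).
  assert (G2 := germ_scal (RtoC (INR n)) _ _ (GU (pred n))).
  generalize (germ_plus _ _ _ G0 (germ_plus _ _ _ G1 G2)).
  apply (germ_imp _ _ z0 (Re z0 - sigma)); [lra|].
  intros h v Hh [w0 [w1 [[v0 [-> ->]] [[w2 [w3 [[w4 [[v2 [HU1 ->]] ->]] [[v1 [HU2 ->]] ->]]]] ->]]]].
  set (z := (z0 + h)%C) in *.
  assert (Hz : sigma < Re z).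
  { unfold z. replace (Re (z0 + h)) with (Re z0 + Re h) by reflexivity.
    generalize (re_le_Cmod h) (Rle_abs (- Re h)). rewrite Rabs_Ropp. lra. }
  assert (Hex : forall m, exists Psi,
    is_primitive a Psi (fun t => H t * RtoC (ln t ^ m) * rcpow t (RtoC sigma - z - 1))%C).
  { intros m. apply ex_primitive; [exact Ha|]. intros t Ht. destruct (Ht) as [Ht0 _].
    apply continuous_Cmult; [apply continuous_Cmult|].
    - now apply HHc.
    - now apply continuous_ln_pow.
    - now apply continuous_rcpow. }
  destruct (Hex n) as [Pn HPn]. destruct (Hex (pred n)) as [Pm HPm].
  specialize (HU1 Pn HPn). specialize (HU2 Pm HPm).
  set (g := fun t => (RtoC (ln t ^ n) * rcpow t (RtoC sigma - z))%C).
  (* The primitive of the integrand obtained by parts; [Pn] and [Pm] absorb the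
     two terms of [g']. *)
  set (Psi := fun t => ((RtoC sigma - z) * Pn t + RtoC (INR n) * Pm t - H t * g t)%C).
  assert (HPsi : is_primitive a Psi (integrand k n z)).
  { intros t Ht. destruct (Ht) as [Ht0 _].
    assert (Hg : Cderive g t (RtoC (INR n * ln t ^ pred n) * rcpow t (- (1)) * rcpow t (RtoC sigma - z) +
      RtoC (ln t ^ n) * ((RtoC sigma - z) * rcpow t (RtoC sigma - z - 1)))%C).
    { apply (Cderive_mult (fun x => RtoC (ln x ^ n)) (fun x => rcpow x (RtoC sigma - z)));
        [now apply Cderive_ln_pow|now apply Cderive_rcpow]. }
    assert (K := Cderive_minus _ _ t _ _ (Cderive_plus _ _ t _ _
        (Cderive_scal (RtoC sigma - z) _ t _ (HPn t Ht)) (Cderive_scal (RtoC (INR n)) _ t _ (HPm t Ht)))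
        (Cderive_mult _ _ t _ _ (HH t Ht) Hg)).
    match type of K with Cderive _ _ ?l => replace (integrand k n z t) with l end; [exact K|].
    cbv beta. unfold integrand, g.
    replace (RtoC sigma - z - 1)%C with (- (1) + (RtoC sigma - z))%C by ring.
    rewrite !rcpow_plus, RtoC_mult.
    replace (rcpow t (- z)) with (rcpow t (- RtoC sigma) * rcpow t (RtoC sigma - z))%C
      by (rewrite <- rcpow_plus; f_equal; ring).
    replace (rcpow t (RtoC sigma - z)) with (rcpow t (RtoC sigma) * rcpow t (- z))%C
      by (rewrite <- rcpow_plus; f_equal; ring).
    ring. }
  intros Phi HPhi.
  apply (Clim_ext (below a) (fun b => H x0 * RtoC (ln x0 ^ n) * rcpow x0 (RtoC sigma - z) +
    (- (1) * ((z - RtoC sigma) * (Pn b - Pn x0)) + RtoC (INR n) * (Pm b - Pm x0)) - H b * g b)%C).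
  { generalize (below_dom a x0 Hx0). apply filter_imp. intros b [_ Hb].
    rewrite (primitive_unique a Phi Psi (integrand k n z) x0 b HPhi HPsi Hx0 Hb).
    unfold Psi, g. ring. }
  match goal with |- Clim _ _ ?l => replace l with (l - 0)%C by ring end.
  apply (Clim_minus (below a)).
  - apply (Clim_plus (below a)); [apply (Clim_const (below a))|].
    apply (Clim_plus (below a)).
    + apply (Clim_scal (below a)). now apply (Clim_scal (below a)).
    + now apply (Clim_scal (below a)).
  - set (eta := Re z - sigma). assert (Heta : 0 < eta) by (unfold eta; lra).
    destruct (ln_pow_bound eta n Heta) as [K [HK Hln]].
    apply (Clim_0_mult_bounded (below a) H g (K * exp (2 * Rabs (ln x0) * eta)) Hlim).
    generalize (below_dom a x0 Hx0). apply filter_imp. intros t [Ht Htd].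
    unfold g. rewrite Cmod_mult, Cmod_R, Cmod_rcpow.
    eapply Rle_trans; [apply Rmult_le_compat_r; [apply Rlt_le, exp_pos|apply Hln]|].
    rewrite Rmult_assoc, <- exp_plus. apply Rmult_le_compat_l; [lra|]. apply exp_le.
    replace (Re (RtoC sigma - z)) with (- eta).
    + assert (Habs := abs_ln_le x0 t (proj1 Hx0) Ht).
      assert (eta * Rabs (ln t) <= eta * (ln t + 2 * Rabs (ln x0))) by (apply Rmult_le_compat_l; lra).
      lra.
    + unfold eta. destruct z as [z1 z2]. unfold Re. simpl. ring.
Qed.

(** * Divergent terms at 0 *)

Lemma at_right_exp (P : R -> Prop) : at_right 0 P -> exists X, forall x, X <= x -> P (exp (- x)).
Proof.
  intros [e He]. assert (He0 := cond_pos e). exists (- ln e + 1). intros x Hx.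
  assert (Hlt : exp (- x) < e).
  { rewrite <- (exp_ln e) by lra. apply exp_increasing. lra. }
  apply He; [|apply exp_pos]. change (Rabs (exp (- x) - 0) < e).
  rewrite Rminus_0_r, Rabs_pos_eq; [exact Hlt|apply Rlt_le, exp_pos].
Qed.

(** Substituting [eps = exp (-x)], the modulus is [|c| * exp (-Re p * x) * x^m].
    It is unbounded if [Re p < 0] or [0 < m].  In the remaining case the term is
    [c * exp (- i * Im p * x)], which changes sign when [x] increases by
    [PI / Im p], whereas its modulus is constant. *)
Lemma fp_term_diverges (c p : C) m : c <> 0 -> p <> 0 -> Re p <= 0 -> diverges_at_0 (fp_term (c, p, m)).
Proof.
  intros Hc Hp Hre [l Hl]. apply Cmod_gt_0 in Hc.
  set (g := fp_term (c, p, m)) in *.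
  assert (Hg : forall x, 0 <= x -> Cmod (g (exp (- x))) = Cmod c * exp (- Re p * x) * x ^ m).
  { intros x Hx. unfold g, fp_term. rewrite !Cmod_mult, Cmod_rcpow, Cmod_R, ln_exp, <- RPow_abs, Rabs_Ropp, (Rabs_pos_eq x Hx).
    do 3 f_equal. ring. }
  assert (Hb := Clim_bounded (at_right 0) g l Hl). apply at_right_exp in Hb. destruct Hb as [X HX].
  set (Y := (Cmod l + 1) / Cmod c). assert (HY : 0 < Y).
  { apply Rdiv_lt_0_compat; [generalize (Cmod_ge_0 l)|]; lra. }
  assert (HYc : Cmod c * Y = Cmod l + 1) by (unfold Y; field; lra).
  assert (Hex : forall x, X <= x -> 0 <= x -> exp (- Re p * x) * x ^ m <= Y).
  { intros x H1 H2. apply (Rmult_le_reg_l (Cmod c)); [exact Hc|]. rewrite HYc, <- Rmult_assoc, <- Hg by exact H2.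
    now apply HX. }
  destruct (Rle_lt_or_eq_dec _ _ Hre) as [Hlt|Heq].
  - (* [exp (-Re p * x)] is at least [1 - Re p * x]. *)
    set (x := Rmax X (Rmax 1 (Y / - Re p))).
    assert (Hx1 : X <= x) by apply Rmax_l.
    assert (Hx2 : Rmax 1 (Y / - Re p) <= x) by apply Rmax_r.
    assert (Hx3 := Rmax_l 1 (Y / - Re p)). assert (Hx4 := Rmax_r 1 (Y / - Re p)).
    assert (K := Hex x Hx1 ltac:(lra)).
    assert (1 <= x ^ m) by (apply pow_R1_Rle; lra).
    assert (Hge := exp_ineq1_le (- Re p * x)).
    assert (HYx : Y <= - Re p * x).
    { replace Y with (- Re p * (Y / - Re p)) by (field; lra). apply Rmult_le_compat_l; lra. }
    assert (exp (- Re p * x) * 1 <= exp (- Re p * x) * x ^ m).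
    { apply Rmult_le_compat_l; [apply Rlt_le, exp_pos|assumption]. }
    lra.
  - assert (Hone : forall x, exp (- Re p * x) = 1).
    { intros x. rewrite Heq. replace (- 0 * x) with 0 by ring. apply exp_0. }
    destruct m as [|m].
    + (* The points [x] and [x + PI / Im p] are taken large enough for the values
         there, which are opposite, to be both within [|c| / 2] of the limit. *)
      set (tau := Im p).
      assert (Htau : tau <> 0).
      { intros E. apply Hp. destruct p as [p1 p2]. unfold Re, Im in *. simpl in *. unfold tau in E.
        rewrite Heq. simpl in E. now rewrite E. }
      assert (Hsmall := proj1 (filterlim_Cmod (at_right 0) g l) Hl (Cmod c / 2) ltac:(lra)).
      apply at_right_exp in Hsmall. destruct Hsmall as [X' HX'].
      set (x := Rmax X' 0 + Rabs (PI / tau)).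
      assert (Habs := Rabs_pos (PI / tau)). assert (Hl1 := Rle_abs (- (PI / tau))). rewrite Rabs_Ropp in Hl1.
      assert (Hm1 := Rmax_l X' 0). assert (Hm2 := Rmax_r X' 0).
      assert (K1 := HX' x ltac:(unfold x; lra)). assert (K2 := HX' (x + PI / tau) ltac:(unfold x; lra)).
      assert (Hopp : g (exp (- (x + PI / tau))) = (- g (exp (- x)))%C).
      { unfold g, fp_term, rcpow. rewrite !ln_exp.
        replace (p * RtoC (- (x + PI / tau)))%C with (p * RtoC (- x) + p * RtoC (- (PI / tau)))%C
          by (rewrite <- Cmult_plus_distr_l, <- RtoC_plus; do 2 f_equal; ring).
        rewrite Cexp_plus.
        assert (E : Cexp (p * RtoC (- (PI / tau))) = (- (1))%C).
        { unfold Cexp. rewrite re_scal_r, im_scal_r, Heq. fold tau.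
          replace (0 * - (PI / tau)) with 0 by ring. replace (tau * - (PI / tau)) with (- PI) by (field; exact Htau).
          rewrite exp_0, cos_neg, sin_neg, cos_PI, sin_PI.
          apply injective_projections; simpl; ring. }
        rewrite E. simpl. ring. }
      rewrite Hopp in K2.
      assert (Hgx := Hg x ltac:(unfold x; lra)). rewrite Hone in Hgx. simpl in Hgx.
      assert (T : Cmod (g (exp (- x)) + g (exp (- x))) < Cmod c).
      { replace (g (exp (- x)) + g (exp (- x)))%C with ((g (exp (- x)) - l) + - (- g (exp (- x)) - l))%C by ring.
        eapply Rle_lt_trans; [apply Cmod_triangle|]. rewrite Cmod_opp. lra. }
      replace (g (exp (- x)) + g (exp (- x)))%C with (RtoC 2 * g (exp (- x)))%C in T by ring.
      rewrite Cmod_mult, Cmod_R, Rabs_pos_eq, Hgx in T by lra. lra.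
    + (* The modulus is at least [|c| * x] for [x >= 1]. *)
      set (x := Rmax X (Rmax 1 (Y + 1))).
      assert (Hx1 : X <= x) by apply Rmax_l.
      assert (Hx2 : Rmax 1 (Y + 1) <= x) by apply Rmax_r.
      assert (Hx3 := Rmax_l 1 (Y + 1)). assert (Hx4 := Rmax_r 1 (Y + 1)).
      assert (K := Hex x Hx1 ltac:(lra)). rewrite Hone in K.
      assert (1 <= x ^ m) by (apply pow_R1_Rle; lra).
      simpl in K. nra.
Qed.

Lemma monomial_lim_0 (p : C) m : 0 < Re p -> Clim (at_right 0) (fun e => RtoC (ln e ^ m) * rcpow e p)%C 0.
Proof.
  intros Hp. set (eta := Re p / 2). assert (Heta : 0 < eta) by (unfold eta; lra).
  destruct (ln_pow_bound eta m Heta) as [K [HK Hln]].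
  apply (Clim_0_le (at_right 0) _ (fun e => K * exp (eta * ln e))).
  - exists (mkposreal 1 Rlt_0_1). intros t Ht Ht0. change (Rabs (t - 0) < 1) in Ht.
    rewrite Rminus_0_r, Rabs_pos_eq in Ht by lra.
    assert (Hl : ln t <= 0) by (rewrite <- ln_1; apply ln_le; lra).
    rewrite Cmod_mult, Cmod_R, Cmod_rcpow.
    eapply Rle_trans; [apply Rmult_le_compat_r; [apply Rlt_le, exp_pos|apply Hln]|].
    rewrite Rmult_assoc, <- exp_plus. apply Rmult_le_compat_l; [lra|]. apply exp_le.
    rewrite Rabs_left1 by exact Hl. replace (Re p) with (2 * eta) by (unfold eta; field). lra.
  - replace 0 with (K * 0) at 2 by ring.
    apply (filterlim_comp _ _ _ (fun e => exp (eta * ln e)) (fun y => K * y) (at_right 0) (locally 0)).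
    + apply (filterlim_comp _ _ _ (fun t => eta * ln t) exp _ (Rbar_locally m_infty)); [|apply is_lim_exp_m].
      apply (filterlim_comp _ _ _ ln (fun y => eta * y) _ (Rbar_locally m_infty)); [apply is_lim_ln_0|].
      replace m_infty with (Rbar_mult eta m_infty) at 2.
      * apply (filterlim_Rbar_mult_l eta m_infty).
      * simpl. destruct (Rle_dec 0 eta) as [H|H]; [|exfalso; lra].
        destruct (Rle_lt_or_eq_dec 0 eta H) as [|E]; [reflexivity|exfalso; lra].
    + exact (filterlim_scal_r (K := R_AbsRing) (V := R_NormedModule) K 0).
Qed.

Lemma pow_ln_prim_lim_0 n (p : C) : 0 < Re p -> Clim (at_right 0) (pow_ln_prim n p) 0.
Proof.
  intros Hp. induction n as [|n IH].
  - apply (Clim_ext (at_right 0) (fun e => / p * (RtoC (ln e ^ 0) * rcpow e p))%C).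
    + apply filter_forall. intros e. simpl. unfold Cdiv. ring.
    + replace (RtoC 0) with (/ p * 0)%C by ring. apply (Clim_scal (at_right 0)). now apply monomial_lim_0.
  - apply (Clim_ext (at_right 0) (fun e => / p * (RtoC (ln e ^ S n) * rcpow e p - RtoC (INR (S n)) * pow_ln_prim n p e))%C).
    + apply filter_forall. intros e.
      change (pow_ln_prim (S n) p e) with ((RtoC (ln e ^ S n) * rcpow e p - RtoC (INR (S n)) * pow_ln_prim n p e) / p)%C.
      unfold Cdiv. ring.
    + replace (RtoC 0) with (/ p * (0 - RtoC (INR (S n)) * 0))%C by ring.
      apply (Clim_scal (at_right 0)), (Clim_minus (at_right 0)); [now apply monomial_lim_0|].
      now apply (Clim_scal (at_right 0)).
Qed.

(** [g] is a sum of admissible divergent terms up to a function tending to 0; the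
    condition leaves no room for a finite nonzero contribution. *)
Definition fp_splits (g : R -> C) : Prop :=
  exists (D : list (C * C * nat)) (Cg : R -> C),
    List.Forall (fun p => diverges_at_0 (fp_term p)) D /\
    (forall e, 0 < e -> g e = (fp_sum D e + Cg e)%C) /\
    Clim (at_right 0) Cg 0.

Lemma fp_splits_0 g : Clim (at_right 0) g 0 -> fp_splits g.
Proof.
  intros H. exists nil, g. split; [constructor|]. split; [|exact H]. intros e _. simpl. ring.
Qed.

Lemma fp_splits_plus g h : fp_splits g -> fp_splits h -> fp_splits (fun e => g e + h e)%C.
Proof.
  intros [D [Cg [HD [Hg HC]]]] [D' [Cg' [HD' [Hg' HC']]]].
  exists (D ++ D'), (fun e => Cg e + Cg' e)%C. split; [now apply Forall_app|]. split.
  - intros e He. rewrite Hg, Hg' by exact He.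
    assert (E : fp_sum (D ++ D') e = (fp_sum D e + fp_sum D' e)%C).
    { unfold fp_sum. clear. induction D as [|q D IH]; simpl; [ring|]. rewrite IH. ring. }
    rewrite E. ring.
  - replace (RtoC 0) with (0 + 0)%C by ring. now apply (Clim_plus (at_right 0)).
Qed.

Lemma fp_splits_ext g h : (forall e, 0 < e -> g e = h e) -> fp_splits g -> fp_splits h.
Proof.
  intros H [D [Cg [HD [Hg HC]]]]. exists D, Cg. split; [exact HD|]. split; [|exact HC].
  intros e He. rewrite <- H by exact He. now apply Hg.
Qed.

Lemma fp_splits_monomial (c p : C) m : p <> 0 -> fp_splits (fp_term (c, p, m)).
Proof.
  intros Hp. destruct (Rlt_or_le 0 (Re p)) as [Hre|Hre].
  - apply fp_splits_0.
    apply (Clim_ext (at_right 0) (fun e => c * (RtoC (ln e ^ m) * rcpow e p))%C).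
    + apply filter_forall. intros e. unfold fp_term. ring.
    + replace (RtoC 0) with (c * 0)%C by ring. apply (Clim_scal (at_right 0)). now apply monomial_lim_0.
  - destruct (classic (c = 0)) as [->|Hc].
    + apply fp_splits_0. apply (Clim_ext (at_right 0) (fun _ => 0)).
      * apply filter_forall. intros e. unfold fp_term. ring.
      * apply (Clim_const (at_right 0)).
    + exists ((c, p, m) :: nil), (fun _ => 0). split; [constructor; [|constructor]; now apply fp_term_diverges|].
      split; [|apply (Clim_const (at_right 0))]. intros e _. unfold fp_sum. simpl. ring.
Qed.

Lemma fp_splits_pow_ln_prim n (p : C) : p <> 0 -> forall c, fp_splits (fun e => c * pow_ln_prim n p e)%C.
Proof.
  intros Hp. induction n as [|n IH]; intros c.
  - apply (fp_splits_ext (fp_term ((c / p)%C, p, 0%nat))); [|now apply fp_splits_monomial].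
    intros e _. simpl. field. exact Hp.
  - apply (fp_splits_ext (fun e => fp_term ((c / p)%C, p, S n) e + (- c * RtoC (INR (S n)) / p) * pow_ln_prim n p e)%C).
    + intros e _. unfold fp_term.
      change (pow_ln_prim (S n) p e) with ((RtoC (ln e ^ S n) * rcpow e p - RtoC (INR (S n)) * pow_ln_prim n p e) / p)%C.
      field. exact Hp.
    + apply fp_splits_plus; [now apply fp_splits_monomial|apply IH].
Qed.

(** * The regularised value of the integral *)

(** The primitive of [ln^n t * t^(-z)] times the Taylor polynomial of [k] with [N]
    terms: all that can diverge at 0. *)
Fixpoint taylor_prim (c : nat -> C) (n : nat) (z : C) (N : nat) (t : R) : C :=
  match N with
  | O => 0
  | S j => (taylor_prim c n z j t + c j * pow_ln_prim n (RtoC (INR (S j)) - z) t)%C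
  end.

Definition not_pos_int (z : C) : Prop := forall j, z <> RtoC (INR (S j)).

Lemma fp_splits_taylor_prim c n z N : not_pos_int z -> fp_splits (fun e => - taylor_prim c n z N e)%C.
Proof.
  intros Hz. induction N as [|N IH].
  - apply (fp_splits_ext (fun _ => 0)); [intros; simpl; ring|].
    apply fp_splits_0, (Clim_const (at_right 0)).
  - apply (fp_splits_ext (fun e => - taylor_prim c n z N e + (- c N) * pow_ln_prim n (RtoC (INR (S N)) - z) e)%C).
    + intros e _. simpl. ring.
    + apply fp_splits_plus; [exact IH|]. apply fp_splits_pow_ln_prim. apply Cminus_eq_contra.
      intros E. now apply (Hz N).
Qed.

Lemma Cderive_taylor_prim c n z N t : not_pos_int z -> 0 < t ->
  Cderive (taylor_prim c n z N) t (psum c t N * RtoC (ln t ^ n) * rcpow t (- z))%C.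
Proof.
  intros Hz Ht. induction N as [|N IH].
  - simpl. replace (0 * RtoC (ln t ^ n) * rcpow t (- z))%C with (RtoC 0) by ring. apply Cderive_const.
  - replace (psum c t (S N) * RtoC (ln t ^ n) * rcpow t (- z))%C with
      (psum c t N * RtoC (ln t ^ n) * rcpow t (- z) + c N * (RtoC (ln t ^ n) * rcpow t (RtoC (INR (S N)) - z - 1)))%C.
    + apply Cderive_plus; [exact IH|]. apply Cderive_scal. apply Cderive_pow_ln_prim; [|exact Ht].
      apply Cminus_eq_contra. intros E. now apply (Hz N).
    + replace (RtoC (INR (S N)) - z - 1)%C with (RtoC (INR N) + - z)%C by (rewrite S_INR, RtoC_plus; ring).
      rewrite rcpow_plus, rcpow_INR by exact Ht. simpl psum. ring.
Qed.

Lemma taylor_prim_lim_raise c n z N M :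
  Re z < INR N + 1 -> Clim (at_right 0) (fun t => taylor_prim c n z (M + N) t - taylor_prim c n z N t)%C 0.
Proof.
  intros Hz. induction M as [|M IH].
  - apply (Clim_ext (at_right 0) (fun _ => 0)); [|apply (Clim_const (at_right 0))].
    apply filter_forall. intros t. simpl. ring.
  - apply (Clim_ext (at_right 0) (fun t => (taylor_prim c n z (M + N) t - taylor_prim c n z N t) +
      c (M + N)%nat * pow_ln_prim n (RtoC (INR (S (M + N))) - z) t)%C).
    + apply filter_forall. intros t. simpl. ring.
    + replace (RtoC 0) with (0 + c (M + N)%nat * 0)%C by ring.
      apply (Clim_plus (at_right 0)); [exact IH|]. apply (Clim_scal (at_right 0)). apply pow_ln_prim_lim_0.
      replace (Re (RtoC (INR (S (M + N))) - z)) with (INR (S (M + N)) - Re z) by reflexivity.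
      rewrite S_INR, plus_INR. generalize (pos_INR M). lra.
Qed.

(** With [Phi] a primitive of the integrand, [l0] is its limit at 0 once the
    Taylor part is removed and [la] its limit at [a].  The bound on [N] only
    guarantees that further Taylor terms would tend to 0. *)
Definition fp_value (a : Rbar) (k : R -> C) (n : nat) (c : nat -> C) (z v : C) : Prop :=
  exists (Phi : R -> C) (N : nat) (l0 la : C),
    is_primitive a Phi (integrand k n z) /\ Re z < INR N + 1 /\
    Clim (at_right 0) (fun t => Phi t - taylor_prim c n z N t)%C l0 /\
    Clim (below a) Phi la /\ v = (la - l0)%C.

(** Two primitives differ by a constant, which cancels in [la - l0]; two
    truncation orders are compared at their sum, the extra terms tending to 0. *)
Lemma fp_value_unique a k n c z v v' : Rbar_lt 0 a -> fp_value a k n c z v -> fp_value a k n c z v' -> v = v'.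
Proof.
  intros Ha [Phi [N [l0 [la [HP [HN [H0 [Hla ->]]]]]]]] [Psi [N' [l0' [la' [HP' [HN' [H0' [Hla' ->]]]]]]]].
  assert (FF := below_proper a Ha). destruct (dom_inhabited a Ha) as [x0 Hx0].
  assert (Hraise : forall N (f : R -> C) l M, Re z < INR N + 1 ->
     Clim (at_right 0) (fun t => f t - taylor_prim c n z N t)%C l ->
     Clim (at_right 0) (fun t => f t - taylor_prim c n z (M + N) t)%C l).
  { intros N1 f l M HN1 Hf.
    apply (Clim_ext (at_right 0) (fun t => (f t - taylor_prim c n z N1 t) - (taylor_prim c n z (M + N1) t - taylor_prim c n z N1 t))%C).
    - apply filter_forall. intros t. ring.
    - replace l with (l - 0)%C by ring. apply (Clim_minus (at_right 0)); [exact Hf|now apply taylor_prim_lim_raise]. }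
  apply (Hraise N Phi l0 N' HN) in H0. apply (Hraise N' Psi l0' N HN') in H0'.
  rewrite PeanoNat.Nat.add_comm in H0'.
  (* [C0] is the constant by which the two primitives differ. *)
  set (C0 := (Phi x0 - Psi x0)%C).
  assert (E : forall t, dom a t -> (Phi t - Psi t = C0)%C).
  { intros t Ht. assert (K := primitive_unique a Phi Psi _ x0 t HP HP' Hx0 Ht).
    unfold C0. replace (Phi t) with ((Phi t - Phi x0) + Phi x0)%C by ring. rewrite K. ring. }
  assert (Ea : (la - la')%C = C0).
  { apply (Clim_unique (below a) (fun t => Phi t - Psi t)%C).
    - now apply (Clim_minus (below a)).
    - apply (Clim_ext (below a) (fun _ => C0)); [|apply (Clim_const (below a))].
      generalize (below_dom a x0 Hx0). apply filter_imp. intros t [_ Ht]. now rewrite E. }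
  assert (E0 : (l0 - l0')%C = C0).
  { apply (Clim_unique (at_right 0) (fun t => (Phi t - taylor_prim c n z (N' + N) t) - (Psi t - taylor_prim c n z (N' + N) t))%C).
    - now apply (Clim_minus (at_right 0)).
    - apply (Clim_ext (at_right 0) (fun _ => C0)); [|apply (Clim_const (at_right 0))].
      generalize (at_right_dom a Ha). apply filter_imp. intros t Ht. rewrite <- (E t Ht). ring. }
  replace (la - l0)%C with ((la - la') - (l0 - l0') + (la' - l0'))%C by ring. rewrite Ea, E0. ring.
Qed.

(** Positive integers are at mutual distance at least 1. *)
Lemma not_pos_int_near z0 : exists rho, 0 < rho /\ forall z, Cmod (z - z0) < rho -> z <> z0 -> not_pos_int z.
Proof.
  assert (Hdist : forall i j, Cmod (RtoC (INR (S i)) - RtoC (INR (S j))) < 1 -> i = j).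
  { intros i j H. rewrite <- RtoC_minus, Cmod_R, !S_INR in H. apply Rabs_def2 in H.
    destruct (Nat.lt_total i j) as [L|[L|L]]; [|exact L|].
    - apply lt_INR in L. assert (K : INR (S i) <= INR j) by (apply le_INR; apply INR_lt in L; lia).
      rewrite S_INR in K. lra.
    - apply lt_INR in L. assert (K : INR (S j) <= INR i) by (apply le_INR; apply INR_lt in L; lia).
      rewrite S_INR in K. lra. }
  destruct (classic (exists j, Cmod (RtoC (INR (S j)) - z0) < / 2)) as [[j Hj]|Hn].
  - destruct (classic (z0 = RtoC (INR (S j)))) as [E|E].
    + exists (/ 2). split; [lra|]. intros z Hz Hne i Ei. apply Hne. rewrite Ei, E. do 3 f_equal.
      apply Hdist. rewrite <- Ei, <- E. lra.
    + assert (Hd : 0 < Cmod (RtoC (INR (S j)) - z0)).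
      { apply Cmod_gt_0, Cminus_eq_contra. congruence. }
      exists (Cmod (RtoC (INR (S j)) - z0)). split; [exact Hd|].
      intros z Hz Hne i Ei.
      assert (i = j).
      { apply Hdist. rewrite <- Ei.
        replace (z - RtoC (INR (S j)))%C with ((z - z0) + - (RtoC (INR (S j)) - z0))%C by ring.
        eapply Rle_lt_trans; [apply Cmod_triangle|]. rewrite Cmod_opp. lra. }
      subst i. rewrite <- Ei in Hz. lra.
  - exists (/ 2). split; [lra|]. intros z Hz _ i Ei. apply Hn. exists i. now rewrite <- Ei.
Qed.

Lemma germ_taylor_prim c n N z0 rho : not_pos_int z0 -> 0 < rho -> germ (fun z v => v = taylor_prim c n z N rho) z0.
Proof.
  intros Hz Hr. induction N as [|N IH]; simpl; [apply germ_const|].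
  generalize (germ_plus _ _ _ IH (germ_scal (c N) _ _ (germ_pow_ln_prim n (RtoC (INR (S N))) z0 rho Hr (Hz N)))).
  apply (germ_imp _ _ z0 1 Rlt_0_1). intros h v _ [v1 [v2 [-> [[v3 [-> ->]] ->]]]]. reflexivity.
Qed.

(** Cut at [rho], inside the disc where the Taylor expansion of [k] is controlled:
    the value is the integral from [rho] to [a], plus the Taylor part evaluated at
    [rho], plus the integral from 0 to [rho] of the Taylor remainder. *)
Lemma fp_value_germ a d k n c rho z0 :
  Rbar_lt 0 a -> class_K a d k -> dom a rho -> rho <= 1 ->
  (forall N, exists M, 0 <= M /\ forall t, 0 < t <= rho -> Cmod (k t - psum c t N) <= M * t ^ N) ->
  Rbar_lt d (Re z0) -> not_pos_int z0 -> germ (fp_value a k n c) z0.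
Proof.
  intros Ha Hk Hrho Hrho1 Hrem Hd Hz0. assert (FF := below_proper a Ha).
  destruct (INR_unbounded (Re z0 + 2)) as [N HN].
  destruct (Hrem N) as [M [HM HMt]].
  assert (G1 := head_germ a d k n c rho M N z0 Ha Hk Hrho Hrho1 HM HMt ltac:(lra)).
  assert (G2 := tail_germ a d k n rho z0 Ha Hk Hrho Hd).
  assert (G3 := germ_taylor_prim c n N z0 rho Hz0 (proj1 Hrho)).
  destruct (not_pos_int_near z0) as [q [Hq Hnear]].
  generalize (germ_plus _ _ _ G2 (germ_plus _ _ _ G3 (germ_scal (-1) _ _ G1))).
  apply (germ_imp _ _ z0 (Rmin q 1)); [apply Rmin_glb_lt; lra|].
  intros h v Hh [v2 [w [H2 [[v3 [w1 [-> [[v1 [H1 ->]] ->]]]] ->]]]].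
  set (z := (z0 + h)%C) in *.
  assert (Hhq := Rlt_le_trans _ _ _ Hh (Rmin_l q 1)). assert (Hh1 := Rlt_le_trans _ _ _ Hh (Rmin_r q 1)).
  assert (Hz : not_pos_int z).
  { destruct (classic (z = z0)) as [E|E]; [now rewrite E|]. apply Hnear; [|exact E].
    unfold z. now replace (z0 + h - z0)%C with h by ring. }
  assert (HzN : Re z < INR N + 1).
  { unfold z. replace (Re (z0 + h)) with (Re z0 + Re h) by reflexivity.
    generalize (re_le_Cmod h) (Rle_abs (Re h)). lra. }
  destruct (ex_primitive a (fun t => (k t - psum c t N) * RtoC (ln t ^ n) * rcpow t (- z))%C Ha) as [Pr HPr].
  { intros t Ht. destruct (Ht) as [Ht0 _].
    apply continuous_Cmult; [apply continuous_Cmult; [apply continuous_Cminus|]|].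
    - now apply (class_K_continuous a d).
    - apply continuous_psum.
    - now apply continuous_ln_pow.
    - now apply continuous_rcpow. }
  set (Phi := fun t => (Pr t + taylor_prim c n z N t)%C).
  assert (HPhi : is_primitive a Phi (integrand k n z)).
  { intros t Ht.
    replace (integrand k n z t) with ((k t - psum c t N) * RtoC (ln t ^ n) * rcpow t (- z)
      + psum c t N * RtoC (ln t ^ n) * rcpow t (- z))%C by (unfold integrand; ring).
    apply Cderive_plus; [now apply HPr|]. apply Cderive_taylor_prim; [exact Hz|apply Ht]. }
  exists Phi, N, (Pr rho + v1)%C, (Phi rho + v2)%C. split; [exact HPhi|]. split; [exact HzN|]. split; [|split].
  - apply (Clim_ext (at_right 0) (fun b => Pr rho + (Pr b - Pr rho))%C).
    + apply filter_forall. intros b. unfold Phi. ring.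
    + apply (Clim_plus (at_right 0)); [apply (Clim_const (at_right 0))|now apply H1].
  - apply (Clim_ext (below a) (fun b => Phi rho + (Phi b - Phi rho))%C).
    + apply filter_forall. intros b. ring.
    + apply (Clim_plus (below a)); [apply (Clim_const (below a))|now apply H2].
  - unfold Phi. ring.
Qed.

Lemma fp_value_is_Mellin a d k n c z v : Rbar_lt 0 a -> class_K a d k -> Re z < 1 ->
  fp_value a k n c z v -> is_Mellin a k n z v.
Proof.
  intros Ha Hk Hz [Phi [N [l0 [la [HP [HN [H0 [Hla ->]]]]]]]].
  assert (FF := below_proper a Ha).
  apply (is_RInt_gen_limits a (at_right 0) (below a) Phi).
  - exact HP.
  - intros t Ht. now apply (continuous_integrand a d).
  - now apply at_right_dom.
  - destruct (dom_inhabited a Ha) as [x0 Hx0]. generalize (below_dom a x0 Hx0). apply filter_imp. tauto.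
  - apply (Clim_ext (at_right 0) (fun t => (Phi t - taylor_prim c n z N t) + (taylor_prim c n z (N + 0) t - taylor_prim c n z 0 t))%C).
    + apply filter_forall. intros t. rewrite PeanoNat.Nat.add_0_r. simpl. ring.
    + replace l0 with (l0 + 0)%C by ring. apply (Clim_plus (at_right 0)); [exact H0|].
      apply taylor_prim_lim_raise. simpl. lra.
  - exact Hla.
Qed.

(** Serves both a finite [a], with [b = a], and the truncations at [b] of the
    integral up to infinity. *)
Lemma regularised_is_fp_finite a d k n c z Phi N l0 (b : R) lb :
  Rbar_lt 0 b -> (forall t, 0 < t < b -> dom a t) -> class_K a d k -> not_pos_int z ->
  is_primitive a Phi (integrand k n z) ->
  Clim (at_right 0) (fun t => Phi t - taylor_prim c n z N t)%C l0 ->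
  Clim (at_left b) Phi lb ->
  is_fp_finite (integrand k n z) b (lb - l0)%C.
Proof.
  intros Hb Hba Hk Hz HP H0 Hlb.
  destruct (fp_splits_taylor_prim c n z N Hz) as [D [Cg [HD [Hg HC]]]].
  exists D, (fun e => (lb - (Phi e - taylor_prim c n z N e)) + Cg e)%C. split; [exact HD|]. split.
  - assert (Hbp : 0 < b) by exact Hb. exists (mkposreal b Hbp). intros e He He0.
    change (Rabs (e - 0) < b) in He. rewrite Rminus_0_r, Rabs_pos_eq in He by lra.
    replace (lb - (Phi e - taylor_prim c n z N e) + Cg e + fp_sum D e)%C with (lb - Phi e)%C.
    + apply (is_RInt_gen_limits b (at_point e) (at_left b) Phi).
      * intros t [Ht1 Ht2]. apply HP, Hba. now split.
      * intros t [Ht1 Ht2]. apply (continuous_integrand a d); [exact Hk|]. apply Hba. now split.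
      * split; [exact He0|exact He].
      * assert (Hd : dom b e) by (split; [exact He0|exact He]).
        generalize (below_dom b e Hd). apply (filter_imp (F := at_left b)). tauto.
      * intros P HPl. unfold filtermap, at_point. now apply locally_singleton in HPl.
      * exact Hlb.
    + assert (K := Hg e He0). replace (lb - (Phi e - taylor_prim c n z N e) + Cg e + fp_sum D e)%C
        with (lb - (Phi e - taylor_prim c n z N e) + (fp_sum D e + Cg e))%C by ring.
      rewrite <- K. ring.
  - replace (lb - l0)%C with ((lb - l0) + 0)%C by ring.
    apply (Clim_plus (at_right 0)); [|exact HC].
    apply (Clim_minus (at_right 0)); [apply (Clim_const (at_right 0))|exact H0].
Qed.

Lemma fp_value_is_fp a d k n c z v : Rbar_lt 0 a -> class_K a d k -> not_pos_int z ->
  fp_value a k n c z v -> is_fp (integrand k n z) a v.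
Proof.
  intros Ha Hk Hz [Phi [N [l0 [la [HP [HN [H0 [Hla ->]]]]]]]].
  destruct a as [a| |]; simpl in Ha; [| |contradiction].
  - apply (regularised_is_fp_finite a d k n c z Phi N l0 a la); auto.
  - exists (fun b => Phi b - l0)%C. split.
    + intros b Hb. apply (regularised_is_fp_finite p_infty d k n c z Phi N l0 b (Phi b)); auto.
      * intros t Ht. split; simpl; [lra|easy].
      * apply (filterlim_filter_le_1 (F := locally b) (G := at_left b)); [apply filter_le_within|].
        apply (Cderive_continuous Phi b (integrand k n z b)). apply HP. split; simpl; [lra|easy].
    + apply (Clim_minus (Rbar_locally p_infty)); [|apply (Clim_const (Rbar_locally p_infty))].
      apply (filterlim_filter_le_1 (F := below p_infty) (G := Rbar_locally p_infty)); [|exact Hla].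
      intros P HPb. unfold below, within in HPb. revert HPb. apply filter_imp. intros t Ht. now apply Ht.
Qed.

(** * The finite part is the continued Mellin transform *)

Theorem theorem5p3 (a : Rbar) (ha : Rbar_lt 0 a) (d : Rbar) (k : R -> C)
    (hk : class_K a d k) (lambda : C) (hlambda : 1 < Re lambda)
    (hint : forall m : nat, (1 <= m)%nat -> lambda <> RtoC (INR m))
    (n : nat) (hn : (1 <= n)%nat) :
  (exists v : C, is_Mellin_star a d k n lambda v) /\
  (forall v : C, is_Mellin_star a d k n lambda v ->
     is_fp (integrand k n lambda) a v).
Proof.
  destruct (class_K_taylor a d k ha hk) as [c [rho [Hrho [Hrho1 Hrem]]]].
  assert (Hd1 : Rbar_lt d 1) by apply hk.
  (* Where the value exists it is unique, so [iota] picks it; at the positive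
     integers [M] is arbitrary, which isolated singularities allow. *)
  set (M := fun z : C => iota (T := C_R_CompleteNormedModule) (fp_value a k n c z)).
  assert (HM : forall z v, fp_value a k n c z v -> M z = v).
  { intros z v Hv.
    apply (fp_value_unique a k n c z (M z) v ha); [|exact Hv].
    apply (iota_correct (V := C_R_CompleteNormedModule) (fp_value a k n c z)).
    exists v. split; [exact Hv|]. intros v' Hv'. now apply (fp_value_unique a k n c z). }
  assert (Hgerm : forall z, Rbar_lt d (Re z) -> not_pos_int z -> germ (fp_value a k n c) z).
  { intros z Hdz Hz. now apply (fp_value_germ a d k n c rho). }
  assert (HMan : forall z, Rbar_lt d (Re z) -> not_pos_int z -> analytic_at M z).
  { intros z Hdz Hz. apply analytic_germ. generalize (Hgerm z Hdz Hz).
    apply (germ_imp _ _ z 1 Rlt_0_1). intros h v _ Hv. symmetry. now apply HM. }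
  assert (HMv : forall z, Rbar_lt d (Re z) -> not_pos_int z -> fp_value a k n c z (M z)).
  { intros z Hdz Hz. destruct (Hgerm z Hdz Hz) as [c' [r [Hr H]]].
    destruct (H 0) as [v [_ Hv]]; [rewrite Cmod_0; exact Hr|].
    replace (z + 0)%C with z in Hv by ring. now rewrite (HM z v Hv). }
  assert (Hlt1 : forall z, Re z < 1 -> not_pos_int z).
  { intros z Hz j E. rewrite E in Hz. rewrite re_RtoC, S_INR in Hz. generalize (pos_INR j). lra. }
  assert (Hge1 : forall z : C, 1 <= Re z -> Rbar_lt d (Re z)).
  { intros z Hz. apply (Rbar_lt_le_trans d 1); [exact Hd1|exact Hz]. }
  assert (Hcont : is_Mellin_continuation a d k n M).
  { split.
    - intros z [Hz1 Hz2]. split; [|now apply HMan; [|apply Hlt1]].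
      apply (fp_value_is_Mellin a d k n c); try assumption. now apply HMv; [|apply Hlt1].
    - intros z Hz. destruct (not_pos_int_near z) as [q [Hq Hnear]].
      destruct (between_sigma d (Re z) (Hge1 z Hz) Hd1) as [sigma [Hs1 [Hs2 _]]].
      apply locally_Cmod. exists (Rmin q (1 - sigma)). split; [apply Rmin_glb_lt; lra|].
      intros w Hw Hne.
      assert (Hw1 := Rlt_le_trans _ _ _ Hw (Rmin_l _ _)). assert (Hw2 := Rlt_le_trans _ _ _ Hw (Rmin_r _ _)).
      apply HMan; [|now apply Hnear].
      apply (Rbar_lt_trans d sigma); [exact Hs1|]. simpl.
      assert (K := re_le_Cmod (w - z)). apply Rle_lt_trans with (2 := Hw2) in K.
      apply Rabs_def2 in K. replace (Re (w - z)) with (Re w - Re z) in K by reflexivity. lra. }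
  assert (Hlni : not_pos_int lambda) by (intros j; apply hint; lia).
  assert (Hld : Rbar_lt d (Re lambda)) by (apply Hge1; lra).
  split.
  - exists (M lambda), M. split; [exact Hcont|]. split; [now apply HMan|reflexivity].
  - intros v [M' [[Hstrip Hpunct] [Hana Hval]]].
    assert (E : v = M lambda).
    { destruct (between_sigma d 1 Hd1 Hd1) as [sigma [Hs1 [Hs2 _]]].
      assert (Hopen : forall z, in_strip d z -> locally z (in_strip d)).
      { intros z [Hz1 Hz2]. destruct (between_sigma d (Re z) Hz1 Hd1) as [s [Hsa [Hsb Hsc]]].
        apply locally_Cmod. exists (Rmin (1 - Re z) (Re z - s)). split; [apply Rmin_glb_lt; lra|].
        intros w Hw.
        assert (Hw1 := Rlt_le_trans _ _ _ Hw (Rmin_l _ _)). assert (Hw2 := Rlt_le_trans _ _ _ Hw (Rmin_r _ _)).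
        assert (K := re_le_Cmod (w - z)).
        assert (K1 := Rle_lt_trans _ _ _ K Hw1). assert (K2 := Rle_lt_trans _ _ _ K Hw2).
        apply Rabs_def2 in K1. apply Rabs_def2 in K2.
        replace (Re (w - z)) with (Re w - Re z) in * by reflexivity.
        split; [|lra]. apply (Rbar_lt_trans d s); [exact Hsa|]. simpl. lra. }
      (* Every point of the segment from [sigma] to [lambda] lies in the strip or
         in the closed half-plane [1 <= Re z]. *)
      rewrite <- Hval. apply Ceq_minus.
      apply (identity_theorem (fun z => M' z - M z)%C (RtoC sigma) lambda).
      - intros s Hs. set (z := seg sigma lambda s).
        assert (Hre : Re z = sigma + s * (Re lambda - sigma)).
        { unfold z, seg. destruct lambda as [l1 l2]. unfold Re. simpl. ring. }
        assert (Hz : sigma <= Re z) by (rewrite Hre; assert (0 <= s * (Re lambda - sigma)) by (apply Rmult_le_pos; lra); lra).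
        assert (Hzd : Rbar_lt d (Re z)) by (apply (Rbar_lt_le_trans d sigma); [exact Hs1|exact Hz]).
        destruct (Rlt_or_le (Re z) 1) as [Hz1|Hz1].
        + unfold locally', within. generalize (Hopen z (conj Hzd Hz1)). apply filter_imp.
          intros w Hw _. apply analytic_minus; [now apply Hstrip|now apply Hcont].
        + unfold locally', within.
          generalize (filter_and _ _ (Hpunct z Hz1) (proj2 Hcont z Hz1)). unfold locally', within.
          apply filter_imp. intros w Hw Hne. destruct (Hw Hne) as [Ha Hb]. now apply analytic_minus.
      - generalize (Hopen (RtoC sigma) (conj Hs1 Hs2)). apply filter_imp. intros w Hw.
        destruct (Hstrip w Hw) as [Hm _]. destruct (proj1 Hcont w Hw) as [Hm' _].
        apply (proj1 (Ceq_minus _ _)).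
        assert (FF := below_proper a ha).
        rewrite <- (is_RInt_gen_unique (V := C_R_CompleteNormedModule) _ _ Hm).
        exact (is_RInt_gen_unique (V := C_R_CompleteNormedModule) _ _ Hm').
      - apply analytic_minus; [exact Hana|now apply HMan]. }
    rewrite E. apply (fp_value_is_fp a d k n c); try assumption. now apply HMv.
Qed.
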